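(* Let $d\ge 2$ be an integer and let $p,n$ be real numbers with $p\ge n>d/2$. Let $v\in\mathbb H^{p}$ and $w\in\mathbb H^{p+1}$. Then $\mathcal P(v,w)\in\mathbb H^{p}$ and $$\|\mathcal P(v,w)\|_p\le \tfrac12 K^{+}_{pn}\big(\|v\|_p\|w\|_{n+1}+\|v\|_n\|w\|_{p+1}\big),$$ where $$K^{+}_{pn}:=\frac{1}{(2\pi)^{d/2}}\sqrt{\sup_{k\in\mathbf Z^d_0}\mathcal K_{pn}(k)},\qquad \mathcal K_{pn}(k):=4|k|^{2p}\sum_{h\in\mathbf Z^d_{0k}}\frac{|P_{h,k-h}|^2}{\big(|h|^p|k-h|^n+|h|^n|k-h|^p\big)^2}.$$ Consequently there are constants $K\ge 0$ such that $\|\mathcal P(v,w)\|_p\le\frac12K(\|v\|_p\|w\|_{n+1}+\|v\|_n\|w\|_{p+1})$ for all $v\in\mathbb H^p$, $w\in\mathbb H^{p+1}$, and the smallest such constant $K_{pn}$ satisfies $K_{pn}\le K^{+}_{pn}$.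
   Context: Notation. $\mathbf T^d=(\mathbf R/2\pi\mathbf Z)^d$; $e_k(x)=(2\pi)^{-d/2}e^{ik\cdot x}$ for $k\in\mathbf Z^d$. For $a,b\in\mathbf C^d$: $a\cdot b=\sum_r a_rb_r$ (no conjugation), $|a|=\sqrt{\overline a\cdot a}$. $\mathbf Z^d_0=\mathbf Z^d\setminus\{0\}$, $\mathbf Z^d_{0k}=\mathbf Z^d\setminus\{0,k\}$. Every $\mathbf R^d$-valued distribution $v$ on $\mathbf T^d$ has a Fourier expansion $v=\sum_{k}v_ke_k$ with $v_k=\overline{v_{-k}}\in\mathbf C^d$. For real $m$, $\mathbb H^m$ is the Sobolev space of $\mathbf R^d$-valued distributions $v$ on $\mathbf T^d$ with zero divergence and zero mean ($k\cdot v_k=0$ for all $k$, $v_0=0$) and $\sum_{k\in\mathbf Z^d_0}|k|^{2m}|v_k|^2<\infty$, with inner product $\langle v|w\rangle_m=\sum_{k\in\mathbf Z^d_0}|k|^{2m}\overline{v_k}\cdot w_k$ and norm $\|v\|_m=\sqrt{\langle v|v\rangle_m}$. For $k\in\mathbf R^d$, $k^\perp=\{a\in\mathbf C^d: k\cdot a=0\}$ and $\mathfrak L_k:\mathbf C^d\to k^\perp$ is the orthogonal projection ($\mathfrak L_kc=c-\frac{k\cdot c}{|k|^2}k$ for $k\neq0$, $\mathfrak L_0c=c$). The Leray projection $\mathfrak L$ acts by $(\mathfrak Lv)_k=\mathfrak L_kv_k$. The Navier-Stokes bilinear map is $\mathcal P(v,w)=\mathfrak L(v\cdot\partial w)$,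 with $(v\cdot\partial w)_s=\sum_{r=1}^dv_r\partial_rw_s$; it is well defined for $v\in\mathbb H^p$, $w\in\mathbb H^{p+1}$, $p>d/2$ (then $v\in L^\infty$ and $\partial_rw\in L^2$). For $h,\ell\in\mathbf Z^d_0$, $P_{h\ell}:h^\perp\times\ell^\perp\to(h+\ell)^\perp$ is the bilinear map $P_{h\ell}(a,b)=\frac{a\cdot\ell}{|\ell|}\,\mathfrak L_{h+\ell}b$, and $|P_{h\ell}|=\min\{Q\ge0:\ |P_{h\ell}(a,b)|\le Q|a||b|\ \text{for all } a\in h^\perp,b\in\ell^\perp\}$. The sums defining $\mathcal K_{pn}(k)$ are finite and $\mathcal K_{pn}$ is bounded on $\mathbf Z^d_0$. *)

(* Defs.v *)
From HB Require Import structures.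
From mathcomp Require Import all_boot all_order all_algebra finmap.
From mathcomp Require Import complex ring.
From mathcomp Require Import all_classical all_reals all_analysis.
From mathcomp Require Import summability.

Set Implicit Arguments.
Unset Strict Implicit.
Unset Printing Implicit Defensive.

Import Order.TTheory GRing.Theory Num.Theory.
Import numFieldNormedType.Exports.

Local Open Scope classical_set_scope.
Local Open Scope complex_scope.
Local Open Scope ring_scope.

Section ComplexVectors.
Variables (R : realType) (d : nat).
Implicit Types (a b c : 'rV[R[i]]_d) (k h l : 'rV[int]_d).

Definition cdot a b : R[i] := \sum_(r < d) a 0 r * b 0 r.

Definition cnorm a : R := Num.sqrt (complex.Re (cdot (map_mx conjc a) a)).

Definition cvec k : 'rV[R[i]]_d := map_mx intr k.

Definition knorm k : R := cnorm (cvec k).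

Definition perp k : set 'rV[R[i]]_d := [set a | cdot (cvec k) a = 0].

Definition leray k c : 'rV[R[i]]_d :=
  if k == 0 then c
  else c - (cdot (cvec k) c / ((knorm k) ^+ 2)%:C) *: cvec k.

Definition Pmap h l a b : 'rV[R[i]]_d :=
  (cdot a (cvec l) / (knorm l)%:C) *: leray (h + l) b.

(* The set of admissible Q is closed, bounded below and (as Pmap is bilinear on
   finite-dimensional spaces) nonempty, so this infimum is its minimum. *)
Definition Pnorm h l : R :=
  inf [set Q : R | 0 <= Q /\
    forall a b, a \in perp h -> b \in perp l ->
      cnorm (Pmap h l a b) <= Q * cnorm a * cnorm b].

End ComplexVectors.

Section Torus.
Variables (R : realType) (d : nat).
Implicit Types (k : 'rV[int]_d) (x : 'rV[R]_d).

(* Functions on the torus are functions on R^d that are 2pi-periodic in each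
   coordinate; they are integrated over the fundamental domain [0, 2pi]^d. *)

Definition phase k x : R := \sum_(r < d) (k 0 r)%:~R * x 0 r.

Definition fourier_basis k x : R[i] :=
  ((2 * pi) `^ (- (d%:R / 2)))%:C * (cos (phase k x) +i* sin (phase k x)).

Definition tcons n (z : measurableTypeR R * n.-tuple (measurableTypeR R)) :
  n.+1.-tuple (measurableTypeR R) :=
  [the n.+1.-tuple (measurableTypeR R) of z.1 :: z.2].

Lemma measurable_tcons n : measurable_fun setT (@tcons n).
Proof. exact: measurable_cons. Qed.

HB.instance Definition _ n :=
  isMeasurableFun.Build _ _ _ _ _ (@measurable_tcons n).

Lemma pi2_gt0 : 0 < 2 * pi :> R.
Proof. by rewrite mulr_gt0 ?pi_gt0. Qed.

(* The uniform probability on [0, 2pi]^n, i.e. Lebesgue measure on [0, 2pi]^n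
   divided by (2pi)^n. *)
Fixpoint torus_prob n : probability (n.-tuple (measurableTypeR R)) R :=
  match n with
  | 0 => \d_([tuple] : 0.-tuple (measurableTypeR R))
  | n'.+1 =>
      distribution (uniform_prob pi2_gt0 \x torus_prob n')%E (@tcons n')
  end.

Definition torus_integral (F : 'rV[R]_d -> R[i]) : R[i] :=
  ((2 * pi) ^+ d)%:C *
  ((\int[torus_prob d]_t complex.Re (F (\row_r tnth t r))) +i*
   (\int[torus_prob d]_t complex.Im (F (\row_r tnth t r)))).

Definition fun_coef (F : 'rV[R]_d -> R[i]) k : R[i] :=
  torus_integral (fun x => conjc (fourier_basis k x) * F x).

(* [summability.sum] is the unconditional sum, i.e. the limit of the finite
   partial sums along the finite subsets of the index type. *)
Definition lattice_sum (c : 'rV[int]_d -> R[i]) : R[i] :=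
  summability.sum (c : _ -> R[i]^o).

End Torus.

Section Distributions.
Variables (R : realType) (d : nat).
Implicit Types (k : 'rV[int]_d) (x : 'rV[R]_d) (f : 'rV[R]_d -> R).

Definition basis_vec (r : 'I_d) : 'rV[R]_d := delta_mx 0 r.

Definition pderiv (r : 'I_d) f : 'rV[R]_d -> R := fun x => 'D_(basis_vec r) f x.

Definition pderivs (s : seq 'I_d) f : 'rV[R]_d -> R := foldr pderiv f s.

Definition smooth f := forall s : seq 'I_d,
  continuous (pderivs s f) /\
  forall r x, derivable (pderivs s f) x (basis_vec r).

Definition torus_periodic f :=
  forall r, periodic f ((2 * pi) *: basis_vec r).

Record test_function := TestFunction {
  test_fun :> 'rV[R]_d -> R;
  test_smooth : smooth test_fun;
  test_periodic : torus_periodic test_fun }.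

(* Linear functionals on the smooth real functions on the torus, continuous for
   the topology of uniform convergence of all derivatives. *)
Record torus_distribution := Distribution {
  pairing :> test_function -> R;
  pairing_linear : forall (a : R) (f g h : test_function),
    (forall x, h x = a * f x + g x) -> pairing h = a * pairing f + pairing g;
  pairing_continuous : exists (C : R) (N : nat),
    forall (f : test_function) (M : R),
      (forall s x, (size s <= N)%N -> `|pderivs s f x| <= M) ->
      `|pairing f| <= C * M }.

Lemma pderivs_rcons s r f : pderivs (rcons s r) f = pderivs s (pderiv r f).
Proof. by rewrite /pderivs foldr_rcons. Qed.

Lemma smooth_pderiv r f : smooth f -> smooth (pderiv r f).
Proof. by move=> sf s; rewrite -pderivs_rcons; exact: (sf (rcons s r)). Qed.

Lemma periodic_pderiv r f : torus_periodic f -> torus_periodic (pderiv r f).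
Proof.
move=> pf q x; rewrite /pderiv /derive.
suff -> : (fun h : R => h^-1 *:
    ((f \o shift (x + (2 * pi) *: basis_vec q)) (h *: basis_vec r)
     - f (x + (2 * pi) *: basis_vec q)))
  = (fun h : R => h^-1 *: ((f \o shift x) (h *: basis_vec r) - f x)) by [].
by apply/funext => h /=; rewrite addrA !pf.
Qed.

Definition test_pderiv r (f : test_function) : test_function :=
  TestFunction (smooth_pderiv r (@test_smooth f))
               (periodic_pderiv r (@test_periodic f)).

Lemma test_derivable (f : test_function) r x : derivable f x (basis_vec r).
Proof. by have [_] := @test_smooth f [::]; exact. Qed.

Section DistributionDerivative.
Variables (r : 'I_d) (u : torus_distribution).

Let dpairing (f : test_function) : R := - u (test_pderiv r f).

Let dpairing_linear (a : R) (f g h : test_function) :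
  (forall x, h x = a * f x + g x) -> dpairing h = a * dpairing f + dpairing g.
Proof.
move=> hE; rewrite /dpairing.
rewrite (@pairing_linear u a (test_pderiv r f) (test_pderiv r g)).
  by rewrite opprD mulrN.
move=> x /=; rewrite /pderiv.
have -> : test_fun h = a *: test_fun f + test_fun g.
  by apply/funext => y; rewrite hE.
have df := @test_derivable f r x; have dg := @test_derivable g r x.
by rewrite (deriveD (derivableZ df) dg) (deriveZ _ df).
Qed.

Let dpairing_continuous : exists (C : R) (N : nat),
  forall (f : test_function) (M : R),
    (forall s x, (size s <= N)%N -> `|pderivs s f x| <= M) ->
    `|dpairing f| <= C * M.
Proof.
have [C [N uC]] := pairing_continuous u.
exists C, N.+1 => f M fM; rewrite /dpairing normrN; apply: uC => s x sN.
by rewrite -pderivs_rcons; apply: fM; rewrite size_rcons.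
Qed.

Definition dist_pderiv : torus_distribution :=
  Distribution dpairing_linear dpairing_continuous.

End DistributionDerivative.

Definition trig k (a b : R) x : R := a * cos (phase k x) + b * sin (phase k x).

Lemma phase_shift k r h x :
  phase k (h *: basis_vec r + x) = h * (k 0 r)%:~R + phase k x.
Proof.
rewrite /phase (eq_bigr (fun q => h * (k 0 r)%:~R * (q == r)%:R
  + (k 0 q)%:~R * x 0 q)); last first.
  move=> q _; rewrite !mxE eqxx /= mulrDr; congr (_ + _).
  by case: eqVneq => [->|_]; rewrite ?mulr0 // !mulr1 mulrC.
rewrite big_split /=; congr (_ + _).
rewrite (bigD1 r) //= eqxx mulr1 big1 ?addr0 // => q /negPf ->.
by rewrite mulr0.
Qed.

Lemma is_derive_trig k a b r x :
  is_derive x (basis_vec r) (trig k a b)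
    (trig k (b * (k 0 r)%:~R) (- (a * (k 0 r)%:~R)) x).
Proof.
pose c : R := (k 0 r)%:~R.
pose G (h : R) : R := a * cos (h * c + phase k x) + b * sin (h * c + phase k x).
have dL h : is_derive h (1 : R) (fun h : R => h * c + phase k x) c.
  have -> : (fun h : R => h * c + phase k x) = c *: (@id R) + cst (phase k x).
    by apply/funext => t; rewrite /= mulrC.
  have := is_deriveD (is_deriveZ c (is_derive_id h (1 : R)))
    (is_derive_cst (phase k x) h (1 : R)).
  by rewrite addr0 /GRing.scale /= mulr1.
have dG : is_derive (0 : R) (1 : R) G (trig k (b * c) (- (a * c)) x).
  have dC := @is_derive1_comp R cos _ 0 _ _ (is_derive_cos _) (dL 0).
  have dS := @is_derive1_comp R sin _ 0 _ _ (is_derive_sin _) (dL 0).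
  have := is_deriveD (is_deriveZ a dC) (is_deriveZ b dS).
  rewrite /G /trig mul0r add0r => dabC; apply: (is_derive_eq dabC).
  rewrite /GRing.scale /=; ring.
have quotE : (fun h : R => h^-1 *: ((trig k a b \o shift x) (h *: basis_vec r)
      - trig k a b x))
  = (fun h : R => h^-1 *: ((G \o shift (0 : R)) (h *: (1 : R)) - G 0)).
  apply/funext => h; rewrite /trig /G /= phase_shift mul0r !add0r addr0.
  by rewrite /GRing.scale /= mulr1.
case: dG => dG G'; split; first by rewrite /derivable quotE.
by rewrite /derive quotE.
Qed.

Lemma pderivs_trig k a b s : exists a' b', pderivs s (trig k a b) = trig k a' b'.
Proof.
elim: s => [|r s [a' [b' IH]]]; first by exists a, b.
exists (b' * (k 0 r)%:~R), (- (a' * (k 0 r)%:~R)).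
rewrite /= IH; apply/funext => x.
exact: (@derive_val _ _ _ _ _ _ _ (is_derive_trig k a' b' r x)).
Qed.

Lemma continuous_phase k : continuous (@phase R d k).
Proof.
apply: continuous_big => [|r _ x]; first exact: add_continuous.
by apply: continuousM; [exact: cst_continuous|exact: coord_continuous].
Qed.

Lemma smooth_trig k a b : smooth (trig k a b).
Proof.
move=> s; have [a' [b' ->]] := pderivs_trig k a b s; split; last first.
  by move=> r x; case: (is_derive_trig k a' b' r x).
have ccos x : {for x, continuous (fun x => cos (phase k x))}.
  by apply: continuous_comp; [exact: continuous_phase|exact: continuous_cos].
have csin x : {for x, continuous (fun x => sin (phase k x))}.
  by apply: continuous_comp; [exact: continuous_phase|exact: continuous_sin].
have cacos x : {for x, continuous (fun x => a' * cos (phase k x))}.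
  by apply: continuousM => //; exact: cst_continuous.
have cbsin x : {for x, continuous (fun x => b' * sin (phase k x))}.
  by apply: continuousM => //; exact: cst_continuous.
by move=> x; exact: (continuousD (cacos x) (cbsin x)).
Qed.

Lemma periodic_int (g : R -> R) (T : R) (z : int) t :
  periodic g T -> g (T * z%:~R + t) = g t.
Proof.
move=> gT; case: z => n.
  by rewrite -pmulrn mulr_natr addrC periodicn.
by rewrite NegzE mulrNz mulrN -pmulrn mulr_natr -(periodicn gT n.+1) addrC addNKr.
Qed.

Lemma periodic_trig k a b : torus_periodic (trig k a b).
Proof.
move=> r x; rewrite /trig [x + _]addrC phase_shift.
have pi2E : 2 * pi = pi *+ 2 :> R by rewrite mulr_natl.
by rewrite pi2E (periodic_int _ _ (@cosD2pi R)) (periodic_int _ _ (@sinD2pi R)).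
Qed.

Definition test_cos k := TestFunction (smooth_trig k 1 0) (periodic_trig k 1 0).
Definition test_sin k := TestFunction (smooth_trig k 0 1) (periodic_trig k 0 1).

(* The pairing of u, extended C-linearly, with the conjugate of e_k. *)
Definition dist_coef (u : torus_distribution) k : R[i] :=
  ((2 * pi) `^ (- (d%:R / 2)))%:C * (u (test_cos k) -i* u (test_sin k)).

(* The function with Fourier expansion sum_k u_k e_k. *)
Definition dist_fun (u : torus_distribution) x : R[i] :=
  lattice_sum (fun k => dist_coef u k * fourier_basis k x).

(* R^d-valued distributions, given by their components. *)
Definition vdistribution := 'I_d -> torus_distribution.

Definition vcoef (v : vdistribution) k : 'rV[R[i]]_d := \row_r dist_coef (v r) k.

Definition sobolev_sqnorm (m : R) (v : vdistribution) : \bar R :=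
  \esum_(k in [set k : 'rV[int]_d | k != 0])
    ((knorm R k) `^ (2 * m) * cnorm (vcoef v k) ^+ 2)%:E.

Definition sobolev (m : R) : set vdistribution :=
  [set v | [/\ forall k, cdot (cvec R k) (vcoef v k) = 0,
               vcoef v 0 = 0 &
               (sobolev_sqnorm m v < +oo)%E]].

Definition sobolev_norm (m : R) (v : vdistribution) : R :=
  Num.sqrt (fine (sobolev_sqnorm m v)).

(* The pointwise product in v.dw; for v in H^p and w in H^(p+1), p > d/2, the
   Fourier series of v and dw converge absolutely, so dist_fun is the function
   each of them is. *)
Definition advection (v w : vdistribution) (s : 'I_d) x : R[i] :=
  \sum_(r < d) dist_fun (v r) x * dist_fun (dist_pderiv r (w s)) x.

(* u = P(v, w). The relation is functional: a distribution is determined by its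
   Fourier coefficients. *)
Definition is_NS_bilinear (v w u : vdistribution) : Prop :=
  forall k, vcoef u k = leray k (\row_s fun_coef (advection v w s) k).

End Distributions.

Section Constants.
Variables (R : realType) (d : nat) (p n : R).
Implicit Types (k h : 'rV[int]_d).

Definition calK_term k h : R :=
  (Pnorm R h (k - h)) ^+ 2 /
  ((knorm R h) `^ p * (knorm R (k - h)) `^ n +
   (knorm R h) `^ n * (knorm R (k - h)) `^ p) ^+ 2.

Definition calK k : \bar R :=
  (4 * (knorm R k) `^ (2 * p))%:E *
  \esum_(h in [set h : 'rV[int]_d | h != 0%R /\ h != k]) (calK_term k h)%:E.

Definition Kplus : R :=
  (2 * pi) `^ (- (d%:R / 2)) *
  Num.sqrt (fine (ereal_sup [set calK k | k in [set k | k != 0]])).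

Definition NS_constant : set R :=
  [set K | 0 <= K /\
    forall v w : vdistribution R d, sobolev p v -> sobolev (p + 1) w ->
    forall u, is_NS_bilinear v w u ->
      sobolev_norm p u <= 2^-1 * K *
        (sobolev_norm p v * sobolev_norm (n + 1) w +
         sobolev_norm n v * sobolev_norm (p + 1) w)].

End Constants.

(* Main.v *)
Require Import Defs.
From mathcomp Require Import all_boot all_order all_algebra.
From mathcomp Require Import all_classical all_reals all_analysis.
From mathcomp Require Import finmap complex ring lra.
From mathcomp Require Import summability measurable_realfun.

(** The k-th Fourier coefficient of P(v, w) is, up to the factor
    i (2pi)^(-d/2), the sum over h + l = k of |l| P_{h,l}(v_h, w_l). With the
    weight W(h, l) = |h|^p |l|^n + |h|^n |l|^p, Cauchy-Schwarz gives

      |P(v, w)_k|^2 <= (2pi)^(-d) (sum |P_{h,l}|^2 / W(h, l)^2)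
                                  (sum W(h, l)^2 |l|^2 |v_h|^2 |w_l|^2),

    both sums being over h + l = k. After multiplication by |k|^(2p), the first
    sum is K_{pn}(k) / 4. Summing over k frees the pair (h, l) in the second sum,
    and since W(h, l) |v_h| |l| |w_l| equals

      (|h|^p |v_h|) (|l|^(n+1) |w_l|) + (|h|^n |v_h|) (|l|^(p+1) |w_l|),

    Minkowski's inequality in l^2 bounds the result by the square of
    |v|_p |w|_{n+1} + |v|_n |w|_{p+1}; this is [convolution_estimate]. The constant
    is finite because |P_{h,l}| <= 1 and |k|^p <= 2^p max(|h|, |l|)^p, which leaves
    lattice sums of |h|^(-2n) with 2n > d: [calK_bounded], from
    [lattice_zeta_bounded].

    The analysis needed to reach the coefficients is soft. Since p > d/2, the
    coefficients of v and of the derivatives of w are absolutely summable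
    ([weighted_l2_bounded_subsums]), so the product v . dw is a uniform limit of
    trigonometric polynomials. The torus integral is continuous for uniform
    convergence and the characters are orthogonal ([Rintegral_torus_phase]);
    hence the coefficients of P(v, w) are limits, uniformly in k, of finite
    convolutions ([NS_coef_approx]). All inequalities are proved for these finite
    sums and pass to the limit ([NS_coef_subsum_le]). The same inequality shows
    that the coefficients are absolutely summable, so that they come from a
    distribution, namely integration against the sum of the Fourier series
    ([regular_distribution]). Finally the smallest constant is the infimum of the
    admissible ones ([NS_constant_inf]). *)

Set Implicit Arguments.
Unset Strict Implicit.
Unset Printing Implicit Defensive.

Import Order.TTheory GRing.Theory Num.Theory.
Import numFieldNormedType.Exports.
Local Open Scope classical_set_scope.
Local Open Scope ring_scope.
Local Open Scope complex_scope.
Local Notation cabs := Normc.normc.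

(** * Cauchy-Schwarz for finite sums *)

Section RealSums.
Context (R : realType).

Lemma sum_ge0_seq (I : Type) (r : seq I) (P : pred I) (f : I -> R) :
  (forall i, 0 <= f i) -> 0 <= \sum_(i <- r | P i) f i.
Proof. by move=> f0; apply: sumr_ge0. Qed.

(** The quadratic form a^2 X + 2 a b S + b^2 Y is a sum of squares, hence
    nonnegative; it is evaluated at a vector that exposes its discriminant. *)
Lemma cauchy_schwarz_sqr (I : Type) (r : seq I) (P : pred I) (x y : I -> R) :
  (\sum_(i <- r | P i) x i * y i) ^+ 2 <=
  (\sum_(i <- r | P i) x i ^+ 2) * (\sum_(i <- r | P i) y i ^+ 2).
Proof.
set X := \sum_(i <- r | P i) x i ^+ 2; set Y := \sum_(i <- r | P i) y i ^+ 2.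
set S := \sum_(i <- r | P i) x i * y i.
have Y0 : 0 <= Y by apply: sum_ge0_seq => i; exact: sqr_ge0.
have X0 : 0 <= X by apply: sum_ge0_seq => i; exact: sqr_ge0.
have quad (a b : R) : 0 <= a ^+ 2 * X + 2 * a * b * S + b ^+ 2 * Y.
  rewrite /X /S /Y !mulr_sumr -!big_split /=; apply: sum_ge0_seq => i.
  have -> : a ^+ 2 * x i ^+ 2 + 2 * a * b * (x i * y i) + b ^+ 2 * y i ^+ 2 =
     (a * x i + b * y i) ^+ 2 by ring.
  exact: sqr_ge0.
have [Y00|Y1] := eqVneq Y 0.
(* Y = 0: the form is affine in b, so its slope S must vanish *)
  have [S0|S0] := eqVneq S 0; first by rewrite S0 Y00 mulr0 expr0n.
  have := quad 1 (- (X + 1) / S); rewrite Y00 mulr0 addr0 expr1n mul1r mulr1.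
  by rewrite -mulrA divfK// => q; lra.
have Yp : 0 < Y by rewrite lt_neqAle eq_sym Y1.
have := quad Y (- S) => q.
have : 0 <= Y * (X * Y - S ^+ 2) by nra.
by rewrite pmulr_rge0// subr_ge0.
Qed.

Lemma cauchy_schwarz (I : Type) (r : seq I) (P : pred I) (x y : I -> R) :
  \sum_(i <- r | P i) x i * y i <=
  Num.sqrt (\sum_(i <- r | P i) x i ^+ 2) *
  Num.sqrt (\sum_(i <- r | P i) y i ^+ 2).
Proof.
have X0 : 0 <= \sum_(i <- r | P i) x i ^+ 2.
  by apply: sum_ge0_seq => i; exact: sqr_ge0.
rewrite -sqrtrM//; apply: le_trans (ler_norm _) _.
by rewrite -sqrtr_sqr ler_wsqrtr// cauchy_schwarz_sqr.
Qed.

End RealSums.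

(** * Absolute value of complex numbers *)

Section ComplexAbs.
Context (R : realType).
Implicit Types (x y : R[i]).

Lemma cabs_ge0 x : 0 <= cabs x.
Proof. by case: x => a b; exact: sqrtr_ge0. Qed.

Lemma cabs_sqr x : cabs x ^+ 2 = complex.Re x ^+ 2 + complex.Im x ^+ 2.
Proof. by case: x => a b /=; rewrite sqr_sqrtr// addr_ge0 ?sqr_ge0. Qed.

Lemma cabs_leD x y : cabs (x + y) <= cabs x + cabs y.
Proof. exact: le_normcD. Qed.

Lemma cabsM x y : cabs (x * y) = cabs x * cabs y.
Proof. exact: Normc.normcM. Qed.

Lemma cabsJ x : cabs (conjc x) = cabs x.
Proof. by case: x => a b /=; rewrite sqrrN. Qed.

Lemma cabs_real (a : R) : cabs a%:C = `|a|.
Proof. by rewrite /= expr0n/= addr0 sqrtr_sqr. Qed.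

Lemma cabs_sum (I : Type) (r : seq I) (P : pred I) (f : I -> R[i]) :
  cabs (\sum_(i <- r | P i) f i) <= \sum_(i <- r | P i) cabs (f i).
Proof.
elim/big_ind2 : _ => [|x1 x2 y1 y2 h1 h2|//]; first by rewrite Normc.normc0.
exact: le_trans (cabs_leD _ _) (lerD h1 h2).
Qed.

Lemma normr_Re_le x : `|complex.Re x| <= cabs x.
Proof.
case: x => a b /=; rewrite -sqrtr_sqr ler_wsqrtr// lerDl; exact: sqr_ge0.
Qed.

Lemma normr_Im_le x : `|complex.Im x| <= cabs x.
Proof.
case: x => a b /=; rewrite -sqrtr_sqr ler_wsqrtr// lerDr; exact: sqr_ge0.
Qed.

Lemma cabs_le_ReIm x : cabs x <= `|complex.Re x| + `|complex.Im x|.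
Proof.
case: x => a b /=; rewrite -[leRHS]ger0_norm ?addr_ge0// -sqrtr_sqr ler_wsqrtr//.
rewrite sqrrD !real_normK ?num_real// -addrA [_ *+ 2 + _]addrC addrA lerDl.
by rewrite mulrn_wge0// mulr_ge0.
Qed.

Lemma conjcB x y : conjc (x - y) = conjc x - conjc y.
Proof. exact: (rmorphB (@conjc R)). Qed.

Lemma conjcM x y : conjc (x * y) = conjc x * conjc y.
Proof. exact: (rmorphM (@conjc R)). Qed.

Lemma conjc_int (z : int) : conjc (z%:~R : R[i]) = z%:~R.
Proof. exact: (rmorph_int (@conjc R)). Qed.

Lemma mulcJ_cabs x : conjc x * x = (cabs x ^+ 2)%:C.
Proof.
rewrite cabs_sqr; case: x => a b; apply/eqP; rewrite eq_complex/=.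
by apply/andP; split; apply/eqP; ring.
Qed.

End ComplexAbs.

(** * The Hermitian norm and the Leray projection of a vector *)

Section Vectors.
Context (R : realType) (d : nat).
Implicit Types (a b c : 'rV[R[i]]_d) (k h l : 'rV[int]_d).

Lemma cdotDl a b c : cdot (a + b) c = cdot a c + cdot b c.
Proof. by rewrite /cdot -big_split; apply: eq_bigr => r _; rewrite !mxE mulrDl. Qed.

Lemma cdotDr a b c : cdot c (a + b) = cdot c a + cdot c b.
Proof. by rewrite /cdot -big_split; apply: eq_bigr => r _; rewrite !mxE mulrDr. Qed.

Lemma cdotZl t a b : cdot (t *: a) b = t * cdot a b.
Proof. by rewrite /cdot mulr_sumr; apply: eq_bigr => r _; rewrite !mxE mulrA. Qed.

Lemma cdotZr t a b : cdot a (t *: b) = t * cdot a b.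
Proof. by rewrite /cdot mulr_sumr; apply: eq_bigr => r _; rewrite !mxE mulrCA. Qed.

Lemma cdotC a b : cdot a b = cdot b a.
Proof. by apply: eq_bigr => r _; rewrite mulrC. Qed.

Lemma cdot0r a : cdot a 0 = 0.
Proof. by rewrite /cdot big1// => r _; rewrite mxE mulr0. Qed.

Lemma cdot0l a : cdot 0 a = 0.
Proof. by rewrite cdotC cdot0r. Qed.

Lemma cdotJ a b : conjc (cdot a b) = cdot (map_mx conjc a) (map_mx conjc b).
Proof. by rewrite /cdot rmorph_sum; apply: eq_bigr => r _; rewrite rmorphM !mxE. Qed.

Lemma cvecJ k : map_mx conjc (cvec R k) = cvec R k.
Proof. by apply/rowP => r; rewrite !mxE; exact: rmorph_int. Qed.

Lemma cvec0 : cvec R (0 : 'rV[int]_d) = 0.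
Proof. by apply/rowP => r; rewrite !mxE. Qed.

Lemma cvecD h l : cvec R (h + l) = cvec R h + cvec R l.
Proof. by apply/rowP => r; rewrite !mxE intrD. Qed.

Lemma cvecN k : cvec R (- k) = - cvec R k.
Proof. by apply/rowP => r; rewrite !mxE rmorphN. Qed.

Lemma cdotJ_cabs a :
  cdot (map_mx conjc a) a = (\sum_(r < d) cabs (a 0 r) ^+ 2)%:C.
Proof.
rewrite /cdot rmorph_sum; apply: eq_bigr => r _.
by rewrite !mxE mulcJ_cabs.
Qed.

Lemma cnorm_sqr a : cnorm a ^+ 2 = \sum_(r < d) cabs (a 0 r) ^+ 2.
Proof.
rewrite /cnorm cdotJ_cabs/= sqr_sqrtr//.
by apply: sum_ge0_seq => r; exact: sqr_ge0.
Qed.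

Lemma cnormE a : cnorm a = Num.sqrt (\sum_(r < d) cabs (a 0 r) ^+ 2).
Proof. by rewrite /cnorm cdotJ_cabs. Qed.

Lemma cnorm_ge0 a : 0 <= cnorm a.
Proof. exact: sqrtr_ge0. Qed.

Lemma cnormZ t a : cnorm (t *: a) = cabs t * cnorm a.
Proof.
apply/eqP; rewrite -(@eqrXn2 _ 2%N)// ?mulr_ge0 ?cabs_ge0 ?cnorm_ge0//.
apply/eqP; rewrite exprMn !cnorm_sqr mulr_sumr; apply: eq_bigr => r _.
by rewrite mxE cabsM exprMn.
Qed.

Lemma cnorm0 : cnorm (0 : 'rV[R[i]]_d) = 0.
Proof. by rewrite -(scale0r 0) cnormZ Normc.normc0 mul0r. Qed.

Lemma cabs_le_cnorm a r : cabs (a 0 r) <= cnorm a.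
Proof.
rewrite -ler_sqr ?nnegrE ?cabs_ge0 ?cnorm_ge0//.
rewrite cnorm_sqr (bigD1 r)//= lerDl; apply: sum_ge0_seq => i; exact: sqr_ge0.
Qed.

Lemma cnorm_eq0 a : cnorm a = 0 -> a = 0.
Proof.
move=> a0; apply/rowP => r; rewrite mxE; apply: Normc.eq0_normc.
by apply/eqP; rewrite eq_le cabs_ge0 andbT -a0 cabs_le_cnorm.
Qed.

Lemma cnorm_le_sum a : cnorm a <= \sum_(r < d) cabs (a 0 r).
Proof.
have s0 : 0 <= \sum_(r < d) cabs (a 0 r) by apply: sum_ge0_seq => r; exact: cabs_ge0.
rewrite -ler_sqr ?nnegrE ?cnorm_ge0// cnorm_sqr expr2 mulr_suml.
apply: ler_sum => r _; rewrite expr2 ler_wpM2l ?cabs_ge0//.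
rewrite (bigD1 r)//= lerDl; apply: sum_ge0_seq => i; exact: cabs_ge0.
Qed.

Lemma cabs_cdot_le a b : cabs (cdot a b) <= cnorm a * cnorm b.
Proof.
rewrite !cnormE /cdot; apply: le_trans; first exact: cabs_sum.
under eq_bigr do rewrite cabsM.
exact: cauchy_schwarz.
Qed.

Lemma cnorm_leD a b : cnorm (a + b) <= cnorm a + cnorm b.
Proof.
rewrite -ler_sqr ?nnegrE ?cnorm_ge0 ?addr_ge0 ?cnorm_ge0//.
rewrite sqrrD !cnorm_sqr.
apply: (@le_trans _ _ (\sum_(r < d) (cabs (a 0 r) + cabs (b 0 r)) ^+ 2)).
  apply: ler_sum => r _; rewrite mxE ler_sqr ?nnegrE ?addr_ge0 ?cabs_ge0//.
  exact: cabs_leD.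
under eq_bigr do rewrite sqrrD.
rewrite 2!big_split /= lerD2r lerD2l sumrMnl lerMn2r/=.
by rewrite !cnormE; exact: cauchy_schwarz.
Qed.

Lemma cnorm_sum (I : Type) (s : seq I) (P : pred I) (f : I -> 'rV[R[i]]_d) :
  cnorm (\sum_(i <- s | P i) f i) <= \sum_(i <- s | P i) cnorm (f i).
Proof.
elim/big_ind2 : _ => [|x1 x2 y1 y2 h1 h2|//]; first by rewrite cnorm0.
exact: le_trans (cnorm_leD _ _) (lerD h1 h2).
Qed.

Lemma knorm_ge0 k : 0 <= knorm R k.
Proof. exact: cnorm_ge0. Qed.

Lemma normr_coord_le_knorm k r : `|(k 0 r)%:~R| <= knorm R k.
Proof.
have := cabs_le_cnorm (cvec R k) r.
by rewrite mxE -(rmorph_int (real_complex R)) cabs_real.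
Qed.

Lemma knorm_ge1 k : k != 0 -> 1 <= knorm R k.
Proof.
move=> k0; have [r kr] : exists r, k 0 r != 0.
  apply/existsP; apply: contraNT k0; rewrite negb_exists => /forallP h.
  by apply/eqP/rowP => r; rewrite mxE; apply/eqP; rewrite -[_ == _]negbK h.
apply: le_trans (normr_coord_le_knorm k r).
by rewrite -intr_norm ler1z -gtz0_ge1 normr_gt0.
Qed.

Lemma knorm_gt0 k : k != 0 -> 0 < knorm R k.
Proof. by move/knorm_ge1; exact: lt_le_trans. Qed.

Lemma knorm_leD h l : knorm R (h + l) <= knorm R h + knorm R l.
Proof. by rewrite /knorm cvecD cnorm_leD. Qed.

Lemma knormN k : knorm R (- k) = knorm R k.
Proof.
by rewrite /knorm cvecN -scaleN1r cnormZ normcN Normc.normc1 mul1r.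
Qed.

Lemma cdot_cvec k : cdot (cvec R k) (cvec R k) = ((knorm R k) ^+ 2)%:C.
Proof. by rewrite -{1}cvecJ cdotJ_cabs -cnorm_sqr. Qed.

Lemma knormC_neq0 k : k != 0 -> ((knorm R k) ^+ 2)%:C != 0 :> R[i].
Proof.
move=> k0; have := knorm_gt0 k0 => kp.
by rewrite -(rmorph0 (real_complex R)) (inj_eq (@complexI R)) sqrf_eq0 gt_eqF.
Qed.

Lemma leray0l a : leray 0 a = a.
Proof. by rewrite /leray eqxx. Qed.

Lemma lerayE k a : k != 0 ->
  leray k a = a - (cdot (cvec R k) a / ((knorm R k) ^+ 2)%:C) *: cvec R k.
Proof. by move=> /negPf k0; rewrite /leray k0. Qed.

Lemma lerayD k a b : leray k (a + b) = leray k a + leray k b.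
Proof.
have [->|k0] := eqVneq k 0; first by rewrite !leray0l.
by rewrite !lerayE// cdotDr mulrDl scalerDl opprD addrACA.
Qed.

Lemma lerayZ k t a : leray k (t *: a) = t *: leray k a.
Proof.
have [->|k0] := eqVneq k 0; first by rewrite !leray0l.
by rewrite !lerayE// cdotZr -mulrA -scalerA scalerBr.
Qed.

Lemma leray0r k : leray k (0 : 'rV[R[i]]_d) = 0.
Proof. by rewrite -(scale0r 0) lerayZ !scale0r. Qed.

Lemma leray_sum k (I : Type) (s : seq I) (P : pred I) (f : I -> 'rV[R[i]]_d) :
  leray k (\sum_(i <- s | P i) f i) = \sum_(i <- s | P i) leray k (f i).
Proof. exact: (big_morph (leray k) (lerayD k) (leray0r k)). Qed.

Lemma lerayJ k a :
  leray (- k) (map_mx conjc a) = map_mx conjc (leray k a).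
Proof.
have [->|k0] := eqVneq k 0; first by rewrite oppr0 !leray0l.
rewrite !lerayE ?oppr_eq0// knormN cvecN -[- cvec R k]scaleN1r cdotZl -{1}cvecJ -cdotJ.
set t := cdot (cvec R k) a; set q : R := knorm R k ^+ 2.
have qJ : conjc (q%:C^-1) = q%:C^-1 by rewrite -fmorphV conjc_real.
apply/rowP => r; rewrite !mxE conjcB !conjcM qJ conjc_int.
by rewrite !mulN1r !mulNr mulrN opprK.
Qed.

Lemma cdot_leray k a : cdot (cvec R k) (leray k a) = 0.
Proof.
have [->|k0] := eqVneq k 0; first by rewrite cvec0 cdot0l.
rewrite lerayE//.
rewrite -scaleN1r cdotDr 2!cdotZr cdot_cvec.
by rewrite divfK ?knormC_neq0// mulN1r subrr.
Qed.

(** The removed multiple of k is orthogonal to what remains, so Pythagoras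
    applies. *)
Lemma cnorm_leray_le k a : cnorm (leray k a) <= cnorm a.
Proof.
rewrite -ler_sqr ?nnegrE ?cnorm_ge0//.
have [->|k0] := eqVneq k 0; first by rewrite leray0l.
set b := leray k a.
have aE : a = b + (cdot (cvec R k) a / ((knorm R k) ^+ 2)%:C) *: cvec R k.
  by rewrite /b lerayE// subrK.
set t := _ / _ in aE.
have cdotN2 (c : 'rV[R[i]]_d) : cdot (map_mx conjc c) c = (cnorm c ^+ 2)%:C.
  by rewrite cdotJ_cabs cnorm_sqr.
suff : (cnorm a ^+ 2)%:C = (cnorm b ^+ 2 + cnorm (t *: cvec R k) ^+ 2)%:C :> R[i].
  by move/complexI ->; rewrite lerDl sqr_ge0.
have bk : cdot b (cvec R k) = 0 by rewrite cdotC cdot_leray.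
have bk' : cdot (map_mx conjc b) (cvec R k) = 0.
  by rewrite -cvecJ -cdotJ bk rmorph0.
rewrite rmorphD/= -!cdotN2 {1 2}aE map_mxD/= cdotDl !cdotDr.
rewrite (_ : map_mx conjc (t *: cvec R k) = conjc t *: cvec R k); last first.
  by rewrite -[in RHS]cvecJ; apply/rowP => r; rewrite !mxE rmorphM.
by rewrite !(cdotZl, cdotZr) bk' cdot_leray !mulr0 addr0 add0r.
Qed.

End Vectors.

(** * The norm of P_{h,l} *)

Section Pnorm.
Context (R : realType) (d : nat).
Implicit Types (a b c : 'rV[R[i]]_d) (k h l : 'rV[int]_d).

Let Padm h l : set R := [set Q : R | 0 <= Q /\
    forall a b, a \in perp h -> b \in perp l ->
      cnorm (Pmap h l a b) <= Q * cnorm a * cnorm b].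

Let Padm1 h l : Padm h l 1.
Proof.
split=> // a b _ _; rewrite mul1r /Pmap cnormZ.
rewrite ler_pM ?cabs_ge0 ?cnorm_ge0 ?cnorm_leray_le// cabsM.
have [l0|l0] := eqVneq (knorm R l) 0.
  by rewrite l0 invr0 Normc.normc0 mulr0 cnorm_ge0.
have lp : 0 < knorm R l by rewrite lt_neqAle eq_sym l0 knorm_ge0.
rewrite -(fmorphV (real_complex R)) cabs_real gtr0_norm ?invr_gt0//.
by rewrite ler_pdivrMr// cabs_cdot_le.
Qed.

Lemma Pnorm_ge0 h l : 0 <= Pnorm R h l.
Proof. by apply: lb_le_inf; [exists 1; exact: Padm1|move=> Q []]. Qed.

(** 1 is admissible, by Cauchy-Schwarz for a . l and because the Leray projection
    is a contraction. *)
Lemma Pnorm_le1 h l : Pnorm R h l <= 1.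
Proof. by apply: ge_inf; [exists 0 => Q []|exact: Padm1]. Qed.

(** The infimum defining the norm is attained: for a and b nonzero, the ratio
    |P(a, b)| / (|a| |b|) is a lower bound of the admissible constants. *)
Lemma Pmap_le h l a b : a \in perp h -> b \in perp l ->
  cnorm (Pmap h l a b) <= Pnorm R h l * cnorm a * cnorm b.
Proof.
move=> ah bl; have [ab0|ab0] := eqVneq (cnorm a * cnorm b) 0.
  have := (Padm1 h l).2 _ _ ah bl.
  by rewrite -!mulrA ab0 !mulr0.
have abp : 0 < cnorm a * cnorm b.
  by rewrite lt_neqAle eq_sym ab0 mulr_ge0// cnorm_ge0.
rewrite -mulrA -ler_pdivrMr//; apply: lb_le_inf; first by exists 1; exact: Padm1.
by move=> Q [_ /(_ _ _ ah bl)]; rewrite ler_pdivrMr// mulrA.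
Qed.

End Pnorm.

(** * Families with bounded finite subsums *)

Section FiniteSubsums.
Context (R : realType) (T : choiceType).
Implicit Types (A B : {fset T}) (f g : T -> R) (S : set T).

Lemma esum_le_of_subsums S f (M : R) :
  (forall A, (forall k, k \in A -> S k) -> \sum_(k <- A) f k <= M) ->
  (\esum_(k in S) (f k)%:E <= M%:E)%E.
Proof.
move=> fM; apply: ge_ereal_sup => _ [X [finX XS] <-].
rewrite fsbig_finite//= sumEFin lee_fin; apply: fM => k.
by rewrite in_fset_set// => /set_mem/XS.
Qed.

Lemma subsum_le_esum S f A : (forall k, k \in A -> S k) ->
  ((\sum_(k <- A) f k)%:E <= \esum_(k in S) (f k)%:E)%E.
Proof.
move=> AS; apply: esum_ge; exists [set` A].
  by split => [|k /= /AS]; first exact: finite_fset.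
by rewrite -fsbig_seq ?fset_uniq// sumEFin.
Qed.

Lemma subsum_le_fine_esum S f A : (forall k, S k -> 0 <= f k) ->
  (\esum_(k in S) (f k)%:E < +oo)%E -> (forall k, k \in A -> S k) ->
  \sum_(k <- A) f k <= fine (\esum_(k in S) (f k)%:E).
Proof.
move=> f0 foo AS; rewrite -lee_fin fineK; first exact: subsum_le_esum.
by rewrite ge0_fin_numE// esum_ge0// => k Sk; rewrite lee_fin f0.
Qed.

Lemma ler_sum_fset f g A : (forall k, k \in A -> f k <= g k) ->
  \sum_(k <- A) f k <= \sum_(k <- A) g k.
Proof.
by move=> fg; rewrite big_seq [leRHS]big_seq; apply: ler_sum.
Qed.

(** For nonnegative f, this is summability of f. *)
Definition has_bounded_subsums f := exists M, forall A, \sum_(k <- A) f k <= M.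

(** Smallness of the tail of f outside A, expressed by finite sums only. *)
Definition tail_le f A (e : R) :=
  forall B, (forall k, k \in B -> k \notin A) -> \sum_(k <- B) f k <= e.

Lemma tail_le_subset f A A' e : (A `<=` A')%fset -> tail_le f A e -> tail_le f A' e.
Proof.
move=> AA' fA B BA'; apply: fA => k /BA'; apply: contraNN; exact: (fsubsetP AA').
Qed.

(** A finite sum within e of the supremum of all of them leaves less than e to
    any finite set disjoint from it. *)
Lemma exists_tail_le f : (forall k, 0 <= f k) -> has_bounded_subsums f ->
  forall e : R, 0 < e -> exists A, tail_le f A e.
Proof.
move=> f0 [M fM] e e0.
pose E := [set x | exists A, x = \sum_(k <- A) f k].
have supE : has_sup E.
  split; first by exists (\sum_(k <- (fset0 : {fset T})) f k), fset0.
  by exists M => _ [A ->].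
have [_ [A ->] supA] := sup_adherent e0 supE.
exists A => B BA.
have AB : [disjoint A & B]%fset.
  rewrite fdisjoint_sym; apply/fdisjointP => k kB; exact: BA.
have : \sum_(k <- (A `|` B)%fset) f k <= sup E.
  by apply: ub_le_sup; [exact: supE.2|exists (A `|` B)%fset].
rewrite (_ : \sum_(k <- _) _ = \sum_(k <- A) f k + \sum_(k <- B) f k); last first.
  rewrite (big_fsetID _ (mem A))/=; congr (_ + _); congr (\sum_(k <- enum_fset _) _);
    apply/fsetP => x; rewrite !inE/=.
    by case: (x \in A); rewrite ?andbF.
  case xB: (x \in B); rewrite ?orbT ?orbF/=; first exact: (BA x xB).
  exact: andbN.
move=> le1; have : sup E - e < \sum_(k <- A) f k := supA; lra.
Qed.

Lemma sumB_le_tail f A B e : (forall k, 0 <= f k) -> tail_le f A e ->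
  (A `<=` B)%fset -> forall c : T -> R[i], (forall k, cabs (c k) <= f k) ->
  cabs (\sum_(k <- B) c k - \sum_(k <- A) c k) <= e.
Proof.
move=> f0 fA AB c cf; rewrite (big_fsetID _ (mem A))/=.
rewrite (_ : [fset x in B | x \in A]%fset = A); last first.
  apply/fsetP => x; rewrite !inE/=; apply: andb_idl; exact: (fsubsetP AB).
rewrite [_ + \sum_(i <- [fset _ in _ | _]%fset) _]addrC addrK.
apply: le_trans; first exact: cabs_sum.
apply: (@le_trans _ _ (\sum_(k <- [fset x in B | x \notin A]%fset) f k)).
  exact: ler_sum.
by apply: fA => k; rewrite !inE => /andP[].
Qed.

End FiniteSubsums.

#[local] Instance totally_proper {I : choiceType} : ProperFilter (@totally I) :=
  totally_filter.

(** * Absolutely convergent lattice sums *)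

Section LatticeSum.
Context (R : realType) (d : nat).
Local Notation Zd := 'rV[int]_d.
Implicit Types (A B : {fset Zd}) (c : Zd -> R[i]) (f : Zd -> R).

Lemma partial_sumE c A : partial_sum (c : Zd -> R[i]^o) A = \sum_(k <- A) c k.
Proof. by rewrite /partial_sum [RHS]big_seq_fsetE. Qed.

Let cvg_of_tails f (g : {fset Zd} -> R) : (forall k, 0 <= f k) ->
    has_bounded_subsums f ->
    (forall A B e, tail_le f A e -> (A `<=` B)%fset -> `|g B - g A| <= e) ->
  cvg (g @ totally).
Proof.
move=> f0 fM gf; apply: cauchy_cvg; apply: cauchy_exP => e e0.
have [A fA] := exists_tail_le f0 fM (divr_gt0 e0 (@ltr0Sn R 1)).
exists (g A); exists A => // B /= AB.
rewrite /ball/= distrC; apply: le_lt_trans (gf _ _ _ fA AB) _.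
by rewrite ltr_pdivrMr// ltr_pMr// ltr1n.
Qed.

(** Absolute convergence makes the partial sums Cauchy along the finite subsets;
    real and imaginary parts converge by completeness of the reals, and the
    limit is within the tail of any finite partial sum. *)
Lemma lattice_sum_approx f c A e : (forall k, cabs (c k) <= f k) ->
  has_bounded_subsums f -> tail_le f A e ->
  cabs (lattice_sum c - \sum_(k <- A) c k) <= e.
Proof.
move=> cf fM fA.
have f0 k : 0 <= f k by exact: le_trans (cabs_ge0 _) (cf k).
have gap (B B' : {fset Zd}) e' : tail_le f B e' -> (B `<=` B')%fset ->
    cabs (\sum_(k <- B') c k - \sum_(k <- B) c k) <= e'.
  by move=> fB BB'; exact: sumB_le_tail f0 fB BB' _ cf.
have ReB (x y : R[i]) : complex.Re x - complex.Re y = complex.Re (x - y).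
  by case: x y => [? ?] [? ?].
have ImB (x y : R[i]) : complex.Im x - complex.Im y = complex.Im (x - y).
  by case: x y => [? ?] [? ?].
have /cvg_ex[/= a ca] : cvg ((fun B : {fset Zd} => complex.Re (\sum_(k <- B) c k)) @ totally).
  apply: cvg_of_tails f0 fM _ => B B' e' fB BB'.
  by rewrite ReB (le_trans (normr_Re_le _))// gap.
have /cvg_ex[/= b cb] : cvg ((fun B : {fset Zd} => complex.Im (\sum_(k <- B) c k)) @ totally).
  apply: cvg_of_tails f0 fM _ => B B' e' fB BB'.
  by rewrite ImB (le_trans (normr_Im_le _))// gap.
have near_le (t : R) : 0 < t ->
    (@totally Zd) (fun B : {fset Zd} => cabs ((a +i* b) - \sum_(k <- B) c k) <= t + t).
  move=> t0; move/cvgrPdist_le : ca => /(_ t t0) ha.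
  move/cvgrPdist_le : cb => /(_ t t0) hb.
  near=> B; apply: le_trans (cabs_le_ReIm _) _; rewrite -ReB -ImB/=.
  by apply: lerD; near: B.
have limE : lattice_sum c = a +i* b.
  suff cS : partial_sum (c : Zd -> R[i]^o) @ totally --> (a +i* b : R[i]^o).
    exact: (cvg_lim (@norm_hausdorff _ R[i]^o) cS).
  apply/cvgrPdist_le => /= z z0.
  have [x xz] : exists x : R, z = x%:C.
    by apply/complex_realP; rewrite ger0_real// ltW.
  move: z0; rewrite xz -(rmorph0 (real_complex R)) ltcR => x0.
  have x2 : 0 < x / 2 by rewrite divr_gt0.
  near=> B; rewrite partial_sumE.
  suff h : cabs (a +i* b - \sum_(k <- B) c k) <= x.
    by rewrite normc_def; rewrite lecR; case: (_ - _) h.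
  by rewrite [leRHS]splitr; near: B; exact: near_le.
rewrite limE; apply/ler_addgt0Pr => t t0.
have t2 : 0 < t / 2 / 2 by rewrite !divr_gt0.
have [B /= _ hB] := near_le _ t2.
have := hB (A `|` B)%fset (fsubsetUr _ _) => /= h1.
have h2 := gap A (A `|` B)%fset e fA (fsubsetUl _ _).
have -> : a +i* b - \sum_(k <- A) c k =
    (a +i* b - \sum_(k <- (A `|` B)%fset) c k) +
    (\sum_(k <- (A `|` B)%fset) c k - \sum_(k <- A) c k) by rewrite addrA subrK.
apply: le_trans (cabs_leD _ _) _; rewrite addrC; apply: lerD => //.
by apply: le_trans h1 _; rewrite -splitr; lra.
Unshelve. all: by end_near.
Qed.

End LatticeSum.

(** * Convergence of the lattice sum of |k|^(-2n) for n > d/2 *)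

Section LatticeZeta.
Context (R : realType).

Let zeta (s : R) (N : nat) : R := \sum_(j < N) j.+1%:R `^ (- s).

Let zeta_odd s N : zeta s (N.*2.+1) =
  1 + \sum_(j < N) (j.*2.+2%:R `^ (- s) + j.*2.+3%:R `^ (- s)).
Proof.
elim: N => [|N IH]; first by rewrite /zeta big_ord0 big_ord1 powR1 addr0.
rewrite [in RHS]big_ord_recr/= addrA -IH doubleS /zeta.
by rewrite big_ord_recr/= big_ord_recr/= addrA.
Qed.

Lemma powRN_le (a b s : R) : 0 <= s -> 0 < a -> a <= b -> b `^ (- s) <= a `^ (- s).
Proof.
move=> s0 a0 ab; have b0 := lt_le_trans a0 ab.
rewrite !powRN lef_pV2 ?posrE ?powR_gt0//.
by apply: ge0_ler_powR => //; rewrite nnegrE ltW.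
Qed.

(** With S_N the sum of the first N terms, pairing each even term with the odd
    term that follows it gives S_(2N+1) <= 1 + 2^(1-s) S_N; as S_N <= S_(2N+1),
    this bounds S_N by 1 / (1 - 2^(1-s)). *)
Lemma zeta_bounded (s : R) : 1 < s ->
  exists C, forall N, \sum_(j < N) j.+1%:R `^ (- s) <= C.
Proof.
move=> s1; pose q : R := 2 `^ (1 - s).
have q1 : q < 1.
  rewrite /q -opprB powRN invf_lt1 ?powR_gt0//.
  apply: (@le_lt_trans _ _ (1 `^ (s - 1))); first by rewrite powR1.
  by apply: gt0_ltr_powR; rewrite ?nnegrE ?ltr1n// subr_gt0.
exists ((1 - q)^-1) => N; rewrite -/(zeta s N).
rewrite -[(1 - q)^-1]mul1r ler_pdivlMr ?subr_gt0// mulrBr mulr1 lerBlDr.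
have s0 : 0 <= s by lra.
have step : zeta s N <= zeta s N.*2.+1.
  rewrite /zeta -!(big_mkord xpredT (fun j => j.+1%:R `^ (- s))).
  rewrite [leRHS](@big_cat_nat _ _ _ N)//=.
    by rewrite lerDl sumr_ge0// => j _; exact: powR_ge0.
  by rewrite -addnn leqW// leq_addr.
apply: le_trans step _; rewrite zeta_odd lerD2l /zeta mulr_suml.
apply: ler_sum => j _.
have -> : j.+1%:R `^ (- s) * q = j.*2.+2%:R `^ (- s) + j.*2.+2%:R `^ (- s) :> R.
  rewrite -doubleS -mul2n natrM powRM// /q powRD; last by rewrite pnatr_eq0 implybT.
  rewrite powRr1//; ring.
by rewrite lerD2l powRN_le// ler_nat.
Qed.

Context (d : nat).
Implicit Types (k : 'rV[int]_d) (A : {fset 'rV[int]_d}).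

Let wt (s : R) (j : nat) : R := (maxn 1 j)%:R `^ (- s).

Let wt_ge0 s j : 0 <= wt s j. Proof. exact: powR_ge0. Qed.

Let sum_prod_wt s : 1 < s ->
  exists C, forall A, \sum_(k <- A) \prod_(r < d) wt s (absz (k 0%R r)) <= C.
Proof.
move=> s1; have [C hC] := zeta_bounded s1.
exists ((2 * (1 + C)) ^+ d) => A.
pose N := \max_(k <- A) \max_(r < d) absz (k 0%R r).
have kN k r : k \in A -> (absz (k 0%R r) <= N)%N.
  move=> kA; apply: leq_trans (leq_bigmax_seq _ kA isT).
  exact: (leq_bigmax (F := fun r => absz (k 0%R r))).
(* an integer is determined by its sign and its absolute value *)
pose h k : {ffun 'I_d -> bool * 'I_N.+1} :=
  [ffun r => (k 0 r < 0, inord (absz (k 0%R r)))].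
pose G (g : {ffun 'I_d -> bool * 'I_N.+1}) := \prod_(r < d) wt s (g r).2.
have hinj : {in A &, injective h}.
  move=> k l kA lA /ffunP hkl; apply/rowP => r.
  have := hkl r; rewrite !ffunE => -[sE /(congr1 val)].
  by rewrite /= !inordK ?ltnS ?kN// => aE; rewrite [k 0 r]intEsign [l 0 r]intEsign sE aE.
have -> : \sum_(k <- A) \prod_(r < d) wt s (absz (k 0%R r)) = \sum_(g <- map h A) G g.
  rewrite big_map big_seq [RHS]big_seq; apply: eq_bigr => k kA.
  by apply: eq_bigr => r _; rewrite ffunE/= inordK// ltnS kN.
rewrite big_uniq ?map_inj_in_uniq ?fset_uniq//.
apply: (@le_trans _ _ (\sum_g G g)).
  rewrite big_mkcond; apply: ler_sum => g _; case: ifP => // _.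
  by apply: prodr_ge0 => r _; exact: wt_ge0.
rewrite -(bigA_distr_bigA (fun (_ : 'I_d) (j : bool * 'I_N.+1) => wt s j.2))/=.
rewrite prodr_const card_ord lerXn2r ?nnegrE//.
- by apply: sumr_ge0 => j _; exact: wt_ge0.
- by rewrite mulr_ge0// addr_ge0//; apply: le_trans (hC 0%N); rewrite big_ord0.
rewrite -(pair_bigA _ (fun (b : bool) (j : 'I_N.+1) => wt s j))/=.
have side : \sum_(j < N.+1) wt s j <= 1 + C.
  rewrite big_ord_recl {1}/wt maxn0 powR1 lerD2l; apply: le_trans (hC N).
  by apply: ler_sum => j _; rewrite /wt lift0 (maxn_idPr _).
by rewrite big_bool mulr_natl mulr2n; exact: lerD.
Qed.

(** Each |k_r| and 1 are at most |k|, so |k|^(-2n) is at most the product over r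
    of max(1, |k_r|)^(-2n/d); the sum of the products factorizes into
    one-dimensional sums with exponent 2n/d > 1. *)
Lemma lattice_zeta_bounded (n : R) : (0 < d)%N -> d%:R / 2 < n ->
  exists C, forall A, (forall k, k \in A -> k != 0) ->
    \sum_(k <- A) knorm R k `^ (- (2 * n)) <= C.
Proof.
move=> d0 dn; have dp : 0 < d%:R :> R by rewrite ltr0n.
pose s := 2 * n / d%:R.
have s1 : 1 < s by rewrite /s ltr_pdivlMr//; lra.
have [C hC] := sum_prod_wt s1; exists C => A A0.
apply: le_trans (hC A); apply: ler_sum_fset => k /A0 k0.
have -> : knorm R k `^ (- (2 * n)) = \prod_(r < d) knorm R k `^ (- s).
  rewrite prodr_const card_ord -powR_mulrn ?powR_ge0// -powRrM; congr (_ `^ _).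
  by rewrite /s mulNr divfK// gt_eqF.
apply: ler_prod => r _; rewrite powR_ge0/= powRN_le ?ltr0n ?leq_max//; first by lra.
rewrite natr_max ge_max knorm_ge1//= natr_absz intr_norm.
exact: normr_coord_le_knorm.
Qed.

End LatticeZeta.

(** * Integrals of cosines and sines over one period *)

Section OneDimension.
Context (R : realType).
Local Notation muU := (uniform_prob (@pi2_gt0 R)).

Lemma bounded_integrable d (T : measurableType d) (mu : probability T R)
    (g : T -> R) (M : R) : measurable_fun setT g -> (forall x, `|g x| <= M) ->
  mu.-integrable setT (EFin \o g).
Proof.
move=> mg gM; apply: measurable_bounded_integrable => //.
  by rewrite ltey_eq fin_num_measure.
exists M; split; first exact: num_real.
by move=> y My x _; exact: le_trans (gM x) (ltW My).
Qed.

Lemma is_derive_trig1 (m a b x : R) :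
  is_derive x (1 : R) (fun t : R => a * cos (m * t) + b * sin (m * t))
    (m * (b * cos (m * x) - a * sin (m * x))).
Proof.
have dL : is_derive x (1 : R) (fun t : R => m * t) m.
  have := is_deriveZ m (is_derive_id x (1 : R)).
  by rewrite /GRing.scale /= mulr1.
have dC := @is_derive1_comp R cos _ x _ _ (is_derive_cos _) dL.
have dS := @is_derive1_comp R sin _ x _ _ (is_derive_sin _) dL.
have := is_deriveD (is_deriveZ a dC) (is_deriveZ b dS) => dab.
apply: (is_derive_eq dab); rewrite /GRing.scale /=; ring.
Qed.

(** The integrand is shifted by 1 to make it nonnegative. Its antiderivative
    x + (a cos (mx) + b sin (mx)) / m grows by exactly 2pi over one period, so the
    mean of the shifted integrand is 1. *)
Lemma Rintegral_trig1 (z : int) : z != 0 ->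
  (\int[muU]_x cos (z%:~R * x) = 0) /\ (\int[muU]_x sin (z%:~R * x) = 0).
Proof.
move=> z0; set m : R := z%:~R; have m0 : m != 0 by rewrite intr_eq0.
have pi2E : 2 * pi = pi *+ 2 :> R by rewrite mulr_natl.
have c2 : cos (m * (2 * pi)) = 1.
  by rewrite pi2E mulrC -[_ * m]addr0 (periodic_int _ _ (@cosD2pi R)) cos0.
have s2 : sin (m * (2 * pi)) = 0.
  by rewrite pi2E mulrC -[_ * m]addr0 (periodic_int _ _ (@sinD2pi R)) sin0.
have main (a b : R) : (forall y, -1 <= b * cos y - a * sin y) ->
    (forall y, b * cos y - a * sin y <= 1) ->
    \int[muU]_x (b * cos (m * x) - a * sin (m * x)) = 0.
  move=> ge le.
  pose g x : R := b * cos (m * x) - a * sin (m * x).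
  pose F x : R := x + m^-1 * (a * cos (m * x) + b * sin (m * x)).
  have dF x : is_derive x (1 : R) F (1 + g x).
    have := is_deriveD (is_derive_id x (1 : R)) (is_deriveZ m^-1 (is_derive_trig1 m a b x)).
    by rewrite /GRing.scale/= mulKf.
  have cg : continuous g.
    have -> : g = fun t : R => b * cos (m * t) + (- a) * sin (m * t).
      by apply/funext => t; rewrite mulNr.
    move=> x; apply: differentiable_continuous; apply/derivable1_diffP.
    by case: (is_derive_trig1 m b (- a) x).
  have c1g : continuous (fun x => 1 + g x).
    by move=> x; apply: continuousD; [exact: cst_continuous|exact: cg].
  have cF : continuous F.
    move=> x; apply: differentiable_continuous; apply/derivable1_diffP.
    by case: (dF x).
  have mg : measurable_fun setT g by exact: continuous_measurable_fun.
  have gM x : `|g x| <= 1 by rewrite ler_norml ge le.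
  have ig := @bounded_integrable _ _ muU _ _ mg gM.
  have : (\int[muU]_x (1 + g x)%:E = 1)%E.
    rewrite integral_uniform; last 2 first.
    - by apply/measurable_EFinP; exact: continuous_measurable_fun.
    - by move=> x; rewrite lee_fin -lerBlDl sub0r; exact: ge.
    rewrite (continuous_FTC2 (F := F)) ?pi2_gt0//.
    - rewrite /F c2 s2 !mulr0 cos0 sin0 !mulr0 add0r -EFinB addrK subr0 -EFinM mulVf//.
      by rewrite gt_eqF// pi2_gt0.
    - exact: continuous_subspaceT.
    - split.
      + by move=> x _; case: (dF x).
      + by apply: cvg_at_right_filter; exact: cF.
      + by apply: cvg_at_left_filter; exact: cF.
    - by move=> x _; rewrite derive1E; exact: derive_val.
  rewrite (_ : \int[muU]_x (1 + g x)%:E = (1 + \int[muU]_x g x)%:E)%E; last first.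
    rewrite -[LHS]fineK; last first.
      apply: integrable_fin_num => //.
      apply: (@bounded_integrable _ _ muU (fun x => 1 + g x) 2).
        exact: continuous_measurable_fun.
      by move=> x; apply: le_trans (ler_normD _ _) _; rewrite normr1 lerD2l.
    congr (_%:E); rewrite -/(Rintegral _ _ _) RintegralD//.
      rewrite Rintegral_cst//; congr (_ + _).
      by rewrite [fine _](_ : _ = 1) ?mulr1//; exact: (congr1 fine (probability_setT muU)).
    by apply: (@bounded_integrable _ _ muU (cst 1) 1) => // x; rewrite normr1.
  by move=> [] /eqP; rewrite -subr_eq0 addrAC subrr add0r => /eqP.
split.
- rewrite -[RHS](main 0 1).
  + by apply: eq_Rintegral => x _; rewrite mul1r mul0r subr0.
  + by move=> y; rewrite mul1r mul0r subr0 cos_geN1.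
  + by move=> y; rewrite mul1r mul0r subr0 cos_le1.
- rewrite -[RHS](main (-1) 0).
  + by apply: eq_Rintegral => x _; rewrite mul0r mulN1r opprK add0r.
  + by move=> y; rewrite mul0r mulN1r opprK add0r sin_geN1.
  + by move=> y; rewrite mul0r mulN1r opprK add0r sin_le1.
Qed.

End OneDimension.

(** * Integrals of characters over the torus *)

Section TorusProb.
Context (R : realType).
Local Notation muU := (uniform_prob (@pi2_gt0 R)).
Local Notation mR := (measurableTypeR R).

(** Fubini's theorem for the recursive definition of the torus measure: the
    first coordinate is integrated last. *)
Lemma Rintegral_torus_cons n (g : n.+1.-tuple mR -> R) (M : R) :
  measurable_fun setT g -> (forall t, `|g t| <= M) ->
  \int[torus_prob R n.+1]_t g t =
  \int[muU]_x (\int[torus_prob R n]_t g (tcons (x, t))).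
Proof.
move=> mg gM; pose f : mR * n.-tuple mR -> R := g \o (@tcons R n).
have mf : measurable_fun setT f.
  by apply: measurableT_comp => //; exact: measurable_tcons.
have intf : (muU \x torus_prob R n)%E.-integrable setT (EFin \o f).
  by apply: (@bounded_integrable _ _ _ _ f M) => // x; exact: gM.
rewrite /Rintegral integral_distribution//; last exact/measurable_EFinP.
rewrite -[in LHS]integral12_prod_meas1//.
congr fine; apply: eq_integral => x _; rewrite /fubini_F fineK//.
apply: integrable_fin_num => //.
apply: (@bounded_integrable _ _ _ _ (fun t => f (x, t)) M) => [|t]; last exact: gM.
by apply: measurableT_comp => //; exact: measurable_pair1.
Qed.

Definition tuple_phase n (k : 'I_n -> int) (t : n.-tuple mR) : R :=
  \sum_(r < n) (k r)%:~R * tnth t r.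

Lemma measurable_tuple_phase n (k : 'I_n -> int) :
  measurable_fun setT (tuple_phase k).
Proof.
apply: measurable_sum => r; apply: measurable_funM => //.
exact: measurable_tnth.
Qed.

Lemma measurable_cos_phase n (k : 'I_n -> int) :
  measurable_fun setT (fun t => cos (tuple_phase k t)).
Proof.
apply: (measurableT_comp _ (measurable_tuple_phase k)).
by apply: continuous_measurable_fun; exact: continuous_cos.
Qed.

Lemma measurable_sin_phase n (k : 'I_n -> int) :
  measurable_fun setT (fun t => sin (tuple_phase k t)).
Proof.
apply: (measurableT_comp _ (measurable_tuple_phase k)).
by apply: continuous_measurable_fun; exact: continuous_sin.
Qed.

Lemma normr_cos_le1 (x : R) : `|cos x| <= 1.
Proof. by rewrite ler_norml cos_geN1 cos_le1. Qed.

Lemma normr_sin_le1 (x : R) : `|sin x| <= 1.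
Proof. by rewrite ler_norml sin_geN1 sin_le1. Qed.

Let int_muU_lin (A B : R) (z : int) :
  \int[muU]_x (A * cos (z%:~R * x) + B * sin (z%:~R * x)) =
  A * (\int[muU]_x cos (z%:~R * x)) + B * (\int[muU]_x sin (z%:~R * x)).
Proof.
have mz : measurable_fun setT (fun x : R => z%:~R * x).
  exact: measurable_funM.
have mc : measurable_fun setT (fun x : mR => cos (z%:~R * x)).
  by apply: (measurableT_comp _ mz); apply: continuous_measurable_fun; exact: continuous_cos.
have ms : measurable_fun setT (fun x : mR => sin (z%:~R * x)).
  by apply: (measurableT_comp _ mz); apply: continuous_measurable_fun; exact: continuous_sin.
have ic := @bounded_integrable _ _ _ muU _ 1 mc (fun x => normr_cos_le1 _).
have isn := @bounded_integrable _ _ _ muU _ 1 ms (fun x => normr_sin_le1 _).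
rewrite RintegralD ?RintegralZl//.
  by apply: (@integrableZl _ _ _ _ setT measurableT A _ ic).
by apply: (@integrableZl _ _ _ _ setT measurableT B _ isn).
Qed.

(** Integrating out one coordinate with the addition formulas leaves a
    combination of the integrals in the other coordinates. *)
Lemma Rintegral_torus_phase n (k : 'I_n -> int) :
  (\int[torus_prob R n]_t cos (tuple_phase k t) = ([forall r, k r == 0])%:R) /\
  (\int[torus_prob R n]_t sin (tuple_phase k t) = 0).
Proof.
elim: n k => [|n IH] k.
  have -> : [forall r, k r == 0] by apply/forallP => -[].
  have ph0 t : tuple_phase k t = 0 by rewrite /tuple_phase big_ord0.
  under eq_Rintegral do rewrite ph0 cos0.
  under [in X in _ /\ X]eq_Rintegral do rewrite ph0 sin0.
  rewrite !Rintegral_cst// mul0r mul1r; split=> //.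
  exact: (congr1 fine (probability_setT (torus_prob R 0))).
pose k' i := k (lift ord0 i).
have phE x t : tuple_phase k (tcons (x, t)) = (k ord0)%:~R * x + tuple_phase k' t.
  rewrite /tuple_phase big_ord_recl; congr (_ + _).
  by apply: eq_bigr => i _; rewrite tnthS.
have [cE sE] := IH k'.
have ic := @bounded_integrable _ _ _ (torus_prob R n) _ 1
  (measurable_cos_phase k') (fun x => normr_cos_le1 _).
have isn := @bounded_integrable _ _ _ (torus_prob R n) _ 1
  (measurable_sin_phase k') (fun x => normr_sin_le1 _).
have inner (A B : R) :
    \int[torus_prob R n]_t (A * cos (tuple_phase k' t) + B * sin (tuple_phase k' t)) =
    A * ([forall r, k' r == 0])%:R.
  rewrite RintegralD ?RintegralZl ?cE ?sE ?mulr0 ?addr0//.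
    by apply: (@integrableZl _ _ _ _ setT measurableT A _ ic).
  by apply: (@integrableZl _ _ _ _ setT measurableT B _ isn).
have allE : [forall r, k r == 0] = (k ord0 == 0) && [forall r, k' r == 0].
  apply/forallP/andP => [h|[h0 /forallP h] r].
    by split=> //; apply/forallP => r; exact: h.
  by case: (unliftP ord0 r) => [j ->|->]; first exact: h.
set b : R := ([forall r, k' r == 0])%:R in inner.
have muc : \int[muU]_x cos ((k ord0)%:~R * x) = (k ord0 == 0)%:R.
  case: eqVneq => [->|k0]; last by case: (Rintegral_trig1 R k0).
  under eq_Rintegral do rewrite mul0r cos0.
  rewrite Rintegral_cst// mul1r; exact: (congr1 fine (probability_setT muU)).
have mus : \int[muU]_x sin ((k ord0)%:~R * x) = 0.
  have [->|k0] := eqVneq (k ord0) 0; last by case: (Rintegral_trig1 R k0).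
  under eq_Rintegral do rewrite mul0r sin0.
  by rewrite Rintegral_cst// mul0r.
split.
- rewrite (Rintegral_torus_cons (M := 1)); last 2 first.
  + exact: measurable_cos_phase.
  + by move=> t; exact: normr_cos_le1.
  rewrite (_ : (fun x => _) =
      fun x : R => b * cos ((k ord0)%:~R * x) + 0 * sin ((k ord0)%:~R * x)).
    by rewrite int_muU_lin muc mul0r addr0 allE -mulnb natrM mulrC.
  apply/funext => x; rewrite mul0r addr0 mulrC -(inner _ (- sin ((k ord0)%:~R * x))).
  by apply: eq_Rintegral => t _; rewrite phE cosD mulNr.
- rewrite (Rintegral_torus_cons (M := 1)); last 2 first.
  + exact: measurable_sin_phase.
  + by move=> t; exact: normr_sin_le1.
  rewrite (_ : (fun x => _) =
      fun x : R => 0 * cos ((k ord0)%:~R * x) + b * sin ((k ord0)%:~R * x)).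
    by rewrite int_muU_lin mus mul0r mulr0 addr0.
  apply/funext => x; rewrite mul0r add0r mulrC -(inner _ (cos ((k ord0)%:~R * x))).
  by apply: eq_Rintegral => t _; rewrite phE sinD.
Qed.

End TorusProb.

(** * The integral of bounded measurable functions on the torus *)

Section TorusIntegral.
Context (R : realType) (d : nat).
Local Notation mR := (measurableTypeR R).
Local Notation mT := (d.-tuple mR).
Implicit Types (F G : 'rV[R]_d -> R[i]) (k h l : 'rV[int]_d) (x : 'rV[R]_d).

Lemma ReD (u v : R[i]) : complex.Re (u + v) = complex.Re u + complex.Re v.
Proof. by case: u v => [? ?] [? ?]. Qed.

Lemma ImD (u v : R[i]) : complex.Im (u + v) = complex.Im u + complex.Im v.
Proof. by case: u v => [? ?] [? ?]. Qed.

Lemma ReM (u v : R[i]) :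
  complex.Re (u * v) = complex.Re u * complex.Re v - complex.Im u * complex.Im v.
Proof. by case: u v => [? ?] [? ?]. Qed.

Lemma ImM (u v : R[i]) :
  complex.Im (u * v) = complex.Re u * complex.Im v + complex.Im u * complex.Re v.
Proof. by case: u v => [? ?] [? ?]. Qed.

Lemma ReJ (u : R[i]) : complex.Re (conjc u) = complex.Re u.
Proof. by case: u. Qed.

Lemma ImJ (u : R[i]) : complex.Im (conjc u) = - complex.Im u.
Proof. by case: u. Qed.

(** A class of complex functions on which the torus integral is linear and that
    is closed under products and uniform limits. Measurability is only asked
    after composition with the coordinates, since the measure lives on tuples. *)
Definition bounded_measurable F : Prop :=
  [/\ measurable_fun setT (fun t : mT => complex.Re (F (\row_r tnth t r))),
      measurable_fun setT (fun t : mT => complex.Im (F (\row_r tnth t r))) &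
      exists M, forall x, cabs (F x) <= M].

Lemma bounded_measurable_ext F G : F =1 G -> bounded_measurable F -> bounded_measurable G.
Proof. by move=> /funext ->. Qed.

Lemma bounded_measurableD F G : bounded_measurable F -> bounded_measurable G ->
  bounded_measurable (fun x => F x + G x).
Proof.
move=> [F1 F2 [M FM]] [G1 G2 [N GN]]; split.
- under eq_fun do rewrite ReD; exact: measurable_funD.
- under eq_fun do rewrite ImD; exact: measurable_funD.
- by exists (M + N) => x; apply: le_trans (cabs_leD _ _) (lerD _ _).
Qed.

Lemma bounded_measurableM F G : bounded_measurable F -> bounded_measurable G ->
  bounded_measurable (fun x => F x * G x).
Proof.
move=> [F1 F2 [M FM]] [G1 G2 [N GN]]; split.
- by under eq_fun do rewrite ReM; apply: measurable_funB; exact: measurable_funM.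
- by under eq_fun do rewrite ImM; apply: measurable_funD; exact: measurable_funM.
- by exists (M * N) => x; rewrite cabsM ler_pM ?cabs_ge0.
Qed.

Lemma bounded_measurable_cst (a : R[i]) : bounded_measurable (fun=> a).
Proof. by split; [exact: measurable_cst|exact: measurable_cst|exists (cabs a)]. Qed.

Lemma bounded_measurable_sum (I : Type) (s : seq I) (F : I -> 'rV[R]_d -> R[i]) :
  (forall i, bounded_measurable (F i)) ->
  bounded_measurable (fun x => \sum_(i <- s) F i x).
Proof.
move=> bF; elim: s => [|i s IH].
  apply: bounded_measurable_ext (bounded_measurable_cst 0) => x.
  by rewrite big_nil.
apply: bounded_measurable_ext (bounded_measurableD (bF i) IH) => x.
by rewrite big_cons.
Qed.

Lemma bounded_measurableJ F : bounded_measurable F ->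
  bounded_measurable (fun x => conjc (F x)).
Proof.
move=> [F1 F2 [M FM]]; split.
- by under eq_fun do rewrite ReJ.
- under eq_fun do rewrite ImJ.
  exact: measurableT_comp.
- by exists M => x; rewrite cabsJ.
Qed.

(** Approximants within 1/m form a sequence, and pointwise limits of sequences
    of measurable functions are measurable. *)
Lemma bounded_measurable_uniform_limit F :
  (forall e : R, 0 < e ->
     exists2 G, bounded_measurable G & forall x, cabs (F x - G x) <= e) ->
  bounded_measurable F.
Proof.
move=> FG.
have eps_gt0 (m : nat) : 0 < (m.+1%:R : R)^-1 by rewrite invr_gt0 ltr0n.
have /boolp.choice[G GP] : forall m : nat, exists G, bounded_measurable G /\
    forall x, cabs (F x - G x) <= m.+1%:R^-1.
  by move=> m; have [G bG hG] := FG _ (eps_gt0 m); exists G.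
have cvgG (P : R[i] -> R) x : (forall u v, `|P u - P v| <= cabs (u - v)) ->
    (fun m => P (G m x)) @ \oo --> P (F x).
  move=> Plip; apply/cvgrPdist_le => e e0.
  near=> m; apply: le_trans (Plip _ _) _; apply: le_trans ((GP m).2 x) _.
  rewrite invf_ple ?posrE ?ltr0n//; near: m.
  exists `|Num.ceil e^-1|%N => // m /= hm.
  apply: le_trans (ceil_ge _) _; apply: le_trans (ler_norm _) _.
  by rewrite -intr_norm -natr_absz ler_nat leqW.
have lipRe (u v : R[i]) : `|complex.Re u - complex.Re v| <= cabs (u - v).
  by apply: le_trans (normr_Re_le _); case: u v => [? ?] [? ?].
have lipIm (u v : R[i]) : `|complex.Im u - complex.Im v| <= cabs (u - v).
  by apply: le_trans (normr_Im_le _); case: u v => [? ?] [? ?].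
split.
- apply: (measurable_fun_cvg (h := fun m t => complex.Re (G m (\row_r tnth t r)))).
    by move=> m; case: (GP m) => -[].
  by move=> t _; exact: cvgG.
- apply: (measurable_fun_cvg (h := fun m t => complex.Im (G m (\row_r tnth t r)))).
    by move=> m; case: (GP m) => -[].
  by move=> t _; exact: cvgG.
- have [[_ _ [M GM]] hG] := GP 0%N; exists (1 + M) => x.
  rewrite -[F x](subrK (G 0%N x)); apply: le_trans (cabs_leD _ _) (lerD _ (GM x)).
  by apply: le_trans (hG x) _; rewrite invr1.
Unshelve. all: by end_near.
Qed.

Lemma bounded_measurable_integrable F : bounded_measurable F ->
  (torus_prob R d).-integrable setT
    (EFin \o (fun t : mT => complex.Re (F (\row_r tnth t r)))) /\
  (torus_prob R d).-integrable setT
    (EFin \o (fun t : mT => complex.Im (F (\row_r tnth t r)))).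
Proof.
move=> [F1 F2 [M FM]]; split; apply: (@bounded_integrable _ _ _ _ _ M) => // t.
- exact: le_trans (normr_Re_le _) (FM _).
- exact: le_trans (normr_Im_le _) (FM _).
Qed.

Lemma torus_integralD F G : bounded_measurable F -> bounded_measurable G ->
  torus_integral (fun x => F x + G x) = torus_integral F + torus_integral G.
Proof.
move=> /bounded_measurable_integrable[F1 F2] /bounded_measurable_integrable[G1 G2].
rewrite /torus_integral -mulrDr; congr (_ * _).
apply/eqP; rewrite eq_complex/=; apply/andP; split; apply/eqP.
  by under eq_Rintegral do rewrite ReD; rewrite RintegralD.
by under eq_Rintegral do rewrite ImD; rewrite RintegralD.
Qed.

Lemma torus_integralZ a F : bounded_measurable F ->
  torus_integral (fun x => a * F x) = a * torus_integral F.
Proof.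
move=> /bounded_measurable_integrable[F1 F2].
rewrite /torus_integral mulrCA; congr (_ * _).
have iZ (b : R) (g : mT -> R) : (torus_prob R d).-integrable setT (EFin \o g) ->
    (torus_prob R d).-integrable setT (EFin \o (fun t => b * g t)).
  by move=> ig; exact: (@integrableZl _ _ _ _ setT measurableT b _ ig).
case: a => a b; apply/eqP; rewrite eq_complex/=; apply/andP; split; apply/eqP.
  under eq_Rintegral do rewrite ReM/=.
  by rewrite RintegralB ?RintegralZl//; exact: iZ.
under eq_Rintegral do rewrite ImM/=.
by rewrite RintegralD ?RintegralZl//; exact: iZ.
Qed.

Lemma torus_integral0 : torus_integral (fun _ : 'rV[R]_d => 0 : R[i]) = 0.
Proof.
have := torus_integralZ 0 (bounded_measurable_cst 0).
by rewrite !mul0r.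
Qed.

Lemma torus_integral_sum (I : Type) (s : seq I) (F : I -> 'rV[R]_d -> R[i]) :
  (forall i, bounded_measurable (F i)) ->
  torus_integral (fun x => \sum_(i <- s) F i x) = \sum_(i <- s) torus_integral (F i).
Proof.
move=> bF; elim: s => [|i s IH].
  rewrite big_nil -[RHS]torus_integral0; congr torus_integral.
  by apply/funext => x; rewrite big_nil.
rewrite big_cons -IH -torus_integralD//; last exact: bounded_measurable_sum.
by congr torus_integral; apply/funext => x; rewrite big_cons.
Qed.

Lemma torus_integralJ F : bounded_measurable F ->
  torus_integral (fun x => conjc (F x)) = conjc (torus_integral F).
Proof.
move=> /bounded_measurable_integrable[F1 F2].
rewrite /torus_integral conjcM conjc_real; congr (_ * _).
apply/eqP; rewrite eq_complex/=; apply/andP; split; apply/eqP.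
  by under eq_Rintegral do rewrite ReJ.
under eq_Rintegral do rewrite ImJ -mulN1r.
by rewrite RintegralZl// mulN1r.
Qed.

Lemma cabs_torus_integral_le F (M : R) : bounded_measurable F ->
  (forall x, cabs (F x) <= M) ->
  cabs (torus_integral F) <= 2 * (2 * pi) ^+ d * M.
Proof.
move=> bF FM; have [F1 F2] := bounded_measurable_integrable bF.
rewrite /torus_integral cabsM cabs_real ger0_norm; last first.
  by rewrite exprn_ge0// ltW// pi2_gt0.
rewrite (_ : 2 * (2 * pi) ^+ d * M = (2 * pi) ^+ d * (2 * M)); last by ring.
rewrite ler_wpM2l ?exprn_ge0 ?(ltW (pi2_gt0 R))//.
have bnd (g : mT -> R) : (torus_prob R d).-integrable setT (EFin \o g) ->
    (forall t, `|g t| <= M) -> `|\int[torus_prob R d]_t g t| <= M.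
  move=> ig gM; apply: le_trans (le_normr_Rintegral measurableT ig) _.
  have -> : M = \int[torus_prob R d]_t M.
    rewrite Rintegral_cst// -[LHS]mulr1; congr (_ * _).
    by apply/esym; exact: (congr1 fine (probability_setT (torus_prob R d))).
  have ic : (torus_prob R d).-integrable setT (EFin \o (fun _ : mT => M)).
    by apply: (@bounded_integrable _ _ _ (torus_prob R d) (cst M) `|M|).
  have iN : (torus_prob R d).-integrable setT (EFin \o (fun t : mT => `|g t|)).
    exact: integrable_norm.
  by apply: (le_Rintegral measurableT iN ic) => t _; exact: gM.
apply: le_trans (cabs_le_ReIm _) _; rewrite mulr_natl mulr2n/=.
apply: lerD; apply: bnd => // t.
- exact: le_trans (normr_Re_le _) (FM _).
- exact: le_trans (normr_Im_le _) (FM _).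
Qed.

Definition character k x : R[i] := cos (phase k x) +i* sin (phase k x).

Lemma phaseD k l x : phase (k + l) x = phase k x + phase l x.
Proof.
by rewrite /phase -big_split; apply: eq_bigr => r _; rewrite mxE intrD mulrDl.
Qed.

Lemma phaseN k x : phase (- k) x = - phase k x :> R.
Proof.
by rewrite /phase -sumrN; apply: eq_bigr => r _; rewrite mxE rmorphN mulNr.
Qed.

Lemma characterD k l x : character (k + l) x = character k x * character l x.
Proof.
rewrite /character phaseD cosD sinD; apply/eqP; rewrite eq_complex/= eqxx/=.
by rewrite addrC.
Qed.

Lemma characterN k x : character (- k) x = conjc (character k x).
Proof. by rewrite /character phaseN cosN sinN. Qed.

Lemma cabs_character k x : cabs (character k x) = 1.
Proof. by rewrite /= cos2Dsin2 sqrtr1. Qed.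

Lemma phase_row k (t : mT) : phase k (\row_r tnth t r) = tuple_phase (k 0) t.
Proof. by apply: eq_bigr => r _; rewrite mxE. Qed.

Lemma bounded_measurable_character k : bounded_measurable (character k).
Proof.
split; last by exists 1 => x; rewrite cabs_character.
- rewrite (_ : (fun t => _) = fun t : mT => cos (tuple_phase (k 0) t)).
    exact: measurable_cos_phase.
  by apply/funext => t; rewrite -phase_row.
- rewrite (_ : (fun t => _) = fun t : mT => sin (tuple_phase (k 0) t)).
    exact: measurable_sin_phase.
  by apply/funext => t; rewrite -phase_row.
Qed.

Lemma torus_integral_character k :
  torus_integral (character k) = ((2 * pi) ^+ d)%:C * (k == 0)%:R.
Proof.
rewrite /torus_integral /=; congr (_ * _).
under eq_Rintegral do rewrite phase_row.
under [X in _ +i* X]eq_Rintegral do rewrite phase_row.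
have [-> ->] := Rintegral_torus_phase R (k 0).
have -> : [forall r, k 0 r == 0] = (k == 0).
  by apply/forallP/eqP => [h|-> r]; [apply/rowP => r; rewrite mxE; exact/eqP|rewrite mxE].
by case: (k == 0).
Qed.

End TorusIntegral.

(** * Fourier coefficients and absolutely convergent Fourier series *)

Section FourierCoefficients.
Context (R : realType) (d : nat).
Local Notation Zd := 'rV[int]_d.
Implicit Types (F G : 'rV[R]_d -> R[i]) (k h l : 'rV[int]_d) (x : 'rV[R]_d).
Implicit Types (A B : {fset Zd}).

(** The common modulus of the basis functions e_k. *)
Definition basis_norm : R := (2 * pi) `^ (- (d%:R / 2)).
Local Notation c0 := basis_norm.

Lemma basis_norm_gt0 : 0 < c0.
Proof. by rewrite powR_gt0// pi2_gt0. Qed.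

Lemma basis_norm_sqr : c0 * c0 * (2 * pi) ^+ d = 1.
Proof.
have p0 := pi2_gt0 R.
have p1 : 2 * pi != 0 :> R by rewrite gt_eqF.
rewrite /c0 -!powRD ?p1 ?implybT// -powR_mulrn ?ltW// -powRD ?p1 ?implybT//.
by rewrite -opprD -splitr addNr powRr0.
Qed.

Lemma fourier_basisE k x : fourier_basis k x = c0%:C * character k x.
Proof. by []. Qed.

Lemma cabs_fourier_basis k x : cabs (fourier_basis k x) = c0.
Proof.
by rewrite fourier_basisE cabsM cabs_character mulr1 cabs_real gtr0_norm// basis_norm_gt0.
Qed.

Lemma fourier_basisN k x : fourier_basis (- k) x = conjc (fourier_basis k x).
Proof. by rewrite !fourier_basisE characterN conjcM conjc_real. Qed.

Lemma bounded_measurable_fourier_basis k : bounded_measurable (@fourier_basis R d k).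
Proof.
apply: (bounded_measurableM (bounded_measurable_cst _ _)).
exact: bounded_measurable_character.
Qed.

Let bmJ k F : bounded_measurable F ->
  bounded_measurable (fun x => conjc (fourier_basis k x) * F x).
Proof.
move=> bF; apply: bounded_measurableM => //; apply: bounded_measurableJ.
exact: bounded_measurable_fourier_basis.
Qed.

Lemma fun_coefD F G k : bounded_measurable F -> bounded_measurable G ->
  fun_coef (fun x => F x + G x) k = fun_coef F k + fun_coef G k.
Proof.
move=> bF bG; rewrite /fun_coef -torus_integralD; [|exact: bmJ..].
by congr torus_integral; apply/funext => x; rewrite mulrDr.
Qed.

Lemma fun_coefZ a F k : bounded_measurable F ->
  fun_coef (fun x => a * F x) k = a * fun_coef F k.
Proof.
move=> bF; rewrite /fun_coef -torus_integralZ; last exact: bmJ.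
by congr torus_integral; apply/funext => x; rewrite mulrCA.
Qed.

Lemma fun_coef_sum (I : Type) (s : seq I) (F : I -> 'rV[R]_d -> R[i]) k :
  (forall i, bounded_measurable (F i)) ->
  fun_coef (fun x => \sum_(i <- s) F i x) k = \sum_(i <- s) fun_coef (F i) k.
Proof.
move=> bF; rewrite /fun_coef -torus_integral_sum; last by move=> i; exact: bmJ.
by congr torus_integral; apply/funext => x; rewrite mulr_sumr.
Qed.

(** The factor 2 comes from estimating real and imaginary parts separately. *)
Definition coef_bound : R := c0 * (2 * (2 * pi) ^+ d).

Lemma coef_bound_ge0 : 0 <= coef_bound.
Proof.
rewrite mulr_ge0 ?ltW ?basis_norm_gt0// mulr_gt0// exprn_gt0//; exact: pi2_gt0.
Qed.

Lemma cabs_fun_coef_le F k (M : R) : bounded_measurable F ->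
  (forall x, cabs (F x) <= M) -> cabs (fun_coef F k) <= coef_bound * M.
Proof.
move=> bF FM; rewrite /coef_bound [c0 * _]mulrC -mulrA.
apply: cabs_torus_integral_le; first exact: bmJ.
move=> x; rewrite cabsM cabsJ cabs_fourier_basis ler_wpM2l//.
by rewrite ltW// basis_norm_gt0.
Qed.

Lemma fun_coef_close F G k (e : R) : bounded_measurable F -> bounded_measurable G ->
  (forall x, cabs (F x - G x) <= e) ->
  cabs (fun_coef F k - fun_coef G k) <= coef_bound * e.
Proof.
move=> bF bG FG.
have bmN : bounded_measurable (fun x => -1 * G x).
  exact: (bounded_measurableM (bounded_measurable_cst _ _)).
rewrite -mulN1r -fun_coefZ// -fun_coefD//.
apply: cabs_fun_coef_le; first exact: bounded_measurableD.
by move=> x; rewrite mulN1r.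
Qed.

Lemma fun_coefJ F k : bounded_measurable F -> (forall x, complex.Im (F x) = 0) ->
  fun_coef F (- k) = conjc (fun_coef F k).
Proof.
move=> bF F0; rewrite /fun_coef -torus_integralJ; last exact: bmJ.
congr torus_integral; apply/funext => x; rewrite fourier_basisN [RHS]conjcM.
by congr (_ * _); case: (F x) (F0 x) => a b /= ->; rewrite oppr0.
Qed.

Lemma fun_coef_basis h k : fun_coef (@fourier_basis R d h) k = (h == k)%:R.
Proof.
transitivity ((c0 * c0)%:C * torus_integral (@character R d (h - k))).
  rewrite -torus_integralZ; last exact: bounded_measurable_character.
  congr torus_integral; apply/funext => x; rewrite characterD characterN.
  rewrite 2!fourier_basisE conjcM conjc_real rmorphM/=; ring.
by rewrite torus_integral_character mulrA -rmorphM basis_norm_sqr mul1r subr_eq0.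
Qed.

Lemma fourier_basisM h l x :
  fourier_basis h x * fourier_basis l x = c0%:C * fourier_basis (h + l) x.
Proof. by rewrite !fourier_basisE characterD; ring. Qed.

Section FourierSeries.
Implicit Types (a b : Zd -> R[i]) (f g : Zd -> R).

Definition fourier_series a x : R[i] := lattice_sum (fun k => a k * fourier_basis k x).

Definition fourier_partial a A x : R[i] := \sum_(k <- A) a k * fourier_basis k x.

Lemma bounded_measurable_partial a A : bounded_measurable (fourier_partial a A).
Proof.
apply: bounded_measurable_sum => k.
apply: (bounded_measurableM (bounded_measurable_cst _ _)).
exact: bounded_measurable_fourier_basis.
Qed.

Lemma fun_coef_partial a A k :
  fun_coef (fourier_partial a A) k = \sum_(h <- A) a h * (h == k)%:R.
Proof.
rewrite fun_coef_sum; last first.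
  move=> h; apply: (bounded_measurableM (bounded_measurable_cst _ _)).
  exact: bounded_measurable_fourier_basis.
apply: eq_bigr => h _; rewrite fun_coefZ ?fun_coef_basis//.
exact: bounded_measurable_fourier_basis.
Qed.

Lemma fun_coef_partialM a b A k :
  fun_coef (fun x => fourier_partial a A x * fourier_partial b A x) k =
  c0%:C * \sum_(h <- A) \sum_(l <- A | h + l == k) a h * b l.
Proof.
have bm h l : bounded_measurable
    (fun x => (a h * b l * c0%:C) * fourier_basis (h + l) x).
  apply: (bounded_measurableM (bounded_measurable_cst _ _)).
  exact: bounded_measurable_fourier_basis.
transitivity (fun_coef (fun x => \sum_(h <- A) \sum_(l <- A)
    (a h * b l * c0%:C) * fourier_basis (h + l) x) k).
  congr (fun_coef _ k); apply/funext => x; rewrite /fourier_partial mulr_suml.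
  apply: eq_bigr => h _; rewrite mulr_sumr; apply: eq_bigr => l _.
  by rewrite -[RHS]mulrA -fourier_basisM; ring.
rewrite fun_coef_sum; last by move=> h; apply: bounded_measurable_sum.
rewrite mulr_sumr; apply: eq_bigr => h _.
rewrite fun_coef_sum// mulr_sumr [RHS]big_mkcond/=; apply: eq_bigr => l _.
rewrite fun_coefZ; last exact: bounded_measurable_fourier_basis.
by rewrite fun_coef_basis; case: eqP => _; rewrite ?mulr1 ?mulr0// mulrC.
Qed.

Lemma fourier_series_approx a f A e x : (forall k, cabs (a k) <= f k) ->
  has_bounded_subsums f -> tail_le f A e ->
  cabs (fourier_series a x - fourier_partial a A x) <= c0 * e.
Proof.
move=> af [M fM] fA.
apply: (@lattice_sum_approx _ _ (fun k => c0 * f k)).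
- move=> k; rewrite cabsM cabs_fourier_basis mulrC ler_wpM2l//.
  by rewrite ltW// basis_norm_gt0.
- exists (c0 * M) => B; rewrite -mulr_sumr ler_wpM2l//.
  by rewrite ltW// basis_norm_gt0.
- move=> B BA; rewrite -mulr_sumr ler_wpM2l ?fA//.
  by rewrite ltW// basis_norm_gt0.
Qed.

Lemma bounded_measurable_series a f : (forall k, cabs (a k) <= f k) ->
  has_bounded_subsums f -> bounded_measurable (fourier_series a).
Proof.
move=> af fM; apply: bounded_measurable_uniform_limit => e e0.
have f0 k : 0 <= f k := le_trans (cabs_ge0 _) (af k).
have [A fA] := exists_tail_le f0 fM (divr_gt0 e0 basis_norm_gt0).
exists (fourier_partial a A); first exact: bounded_measurable_partial.
move=> x; apply: le_trans (fourier_series_approx x af fM fA) _.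
by rewrite mulrC divfK// gt_eqF// basis_norm_gt0.
Qed.

(** Partial sums over sets of frequencies stable under k -> -k are real, and they
    are uniformly close to the series. *)
Lemma fourier_series_real a f : (forall k, cabs (a k) <= f k) ->
  has_bounded_subsums f -> (forall k, a (- k) = conjc (a k)) ->
  forall x, complex.Im (fourier_series a x) = 0.
Proof.
move=> af fM aJ x; apply/eqP; rewrite -normr_eq0 eq_le normr_ge0 andbT.
apply/ler_addgt0Pr => e e0; rewrite add0r.
have f0 k : 0 <= f k := le_trans (cabs_ge0 _) (af k).
have [A fA] := exists_tail_le f0 fM (divr_gt0 e0 basis_norm_gt0).
pose S := (A `|` [fset - k | k in A])%fset.
have memN k : (k \in [fset - h | h in A]%fset) = (- k \in A).
  apply/imfsetP/idP => [[h /= hA ->]|kA]; first by rewrite opprK.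
  by exists (- k); rewrite ?opprK.
have SN k : (- k \in S) = (k \in S).
  by rewrite [LHS]in_fsetU [RHS]in_fsetU !memN opprK orbC.
have fS := tail_le_subset (fsubsetUl A [fset - k | k in A]%fset) fA.
have SE : [fset - k | k in S]%fset = S.
  apply/fsetP => k; apply/imfsetP/idP => [[l /= lS ->]|kS]; first by rewrite SN.
  by exists (- k); rewrite /= ?SN// opprK.
have reindexN (F : Zd -> R[i]) : \sum_(k <- S) F k = \sum_(k <- S) F (- k).
  rewrite -{1}SE big_imfset//= => y z _ _ /= yz.
  by rewrite -[y]opprK yz opprK.
have real : complex.Im (fourier_partial a S x) = 0.
  have : conjc (fourier_partial a S x) = fourier_partial a S x.
    rewrite /fourier_partial rmorph_sum [RHS]reindexN.
    by apply: eq_bigr => k _; rewrite aJ fourier_basisN [LHS]conjcM.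
  case: (fourier_partial a S x) => u v /= [] /eqP.
  by rewrite eq_sym -addr_eq0 -mulr2n mulrn_eq0/= => /eqP.
have := fourier_series_approx x af fM fS; rewrite mulrC divfK ?gt_eqF ?basis_norm_gt0//.
apply: le_trans; apply: le_trans (normr_Im_le _).
by rewrite ImD -(mulN1r (fourier_partial _ _ _)) ImM/= real mulr0 add0r oppr0 mul0r addr0.
Qed.

(** The coefficient map is continuous for uniform convergence and exact on
    trigonometric polynomials. *)
Lemma fun_coef_series a f k : (forall h, cabs (a h) <= f h) ->
  has_bounded_subsums f -> fun_coef (fourier_series a) k = a k.
Proof.
move=> af fM; apply/eqP; rewrite -subr_eq0; apply/eqP/Normc.eq0_normc/eqP.
rewrite eq_le cabs_ge0 andbT; apply/ler_addgt0Pr => e e0; rewrite add0r.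
have f0 h : 0 <= f h := le_trans (cabs_ge0 _) (af h).
pose K := coef_bound * c0 + 1.
have K0 : 0 < K.
  by rewrite ltr_wpDl// mulr_ge0 ?coef_bound_ge0 ?ltW ?basis_norm_gt0.
have [A fA] := exists_tail_le f0 fM (divr_gt0 e0 K0).
have fkA := tail_le_subset (fsubsetU1 k A) fA.
have akE : fun_coef (fourier_partial a (k |` A)%fset) k = a k.
  rewrite fun_coef_partial (big_fsetD1 k) ?fset1U1//= eqxx mulr1 big_seq big1 ?addr0//.
  by move=> h; rewrite !inE => /andP[/negPf -> _]; rewrite mulr0.
rewrite -akE; apply: (@le_trans _ _ (coef_bound * (c0 * (e / K)))).
  apply: fun_coef_close.
  - exact: bounded_measurable_series af fM.
  - exact: bounded_measurable_partial.
  - by move=> x; exact: fourier_series_approx.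
have -> : coef_bound * (c0 * (e / K)) = e * (coef_bound * c0 / K).
  by rewrite mulrA [RHS]mulrCA.
by rewrite ler_piMr ?ltW// ltr_pdivrMr// mul1r ltrDl.
Qed.

(** The product of the partial sums over A is uniformly close to the product of
    the series, and its coefficients are finite convolutions. *)
Lemma fun_coef_seriesM_approx a b f g (Mf Mg : R) A e k :
  (forall h, cabs (a h) <= f h) -> (forall h, cabs (b h) <= g h) ->
  (forall B, \sum_(h <- B) f h <= Mf) -> (forall B, \sum_(h <- B) g h <= Mg) ->
  tail_le f A e -> tail_le g A e ->
  cabs (fun_coef (fun x => fourier_series a x * fourier_series b x) k -
        c0%:C * \sum_(h <- A) \sum_(l <- A | h + l == k) a h * b l)
  <= coef_bound * (c0 * c0 * (Mf + Mg) * e).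
Proof.
move=> af bg fM gM fA gA; rewrite -fun_coef_partialM.
have bf : has_bounded_subsums f by exists Mf.
have bg' : has_bounded_subsums g by exists Mg.
have c00 := ltW basis_norm_gt0.
have e0 : 0 <= e by have := fA fset0; rewrite big_seq_fset0; apply=> h.
have Mf0 : 0 <= Mf by have := fM fset0; rewrite big_seq_fset0.
apply: fun_coef_close.
- apply: bounded_measurableM; [exact: bounded_measurable_series af bf|].
  exact: bounded_measurable_series bg bg'.
- by apply: bounded_measurableM; exact: bounded_measurable_partial.
move=> x; set V := fourier_series a x; set W := fourier_series b x.
set VA := fourier_partial a A x; set WA := fourier_partial b A x.
have WM : cabs W <= c0 * Mg.
  have g0 : tail_le g fset0 Mg by move=> B _.
  have := fourier_series_approx x bg bg' g0.
  by rewrite /fourier_partial big_seq_fset0 subr0.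
have VAM : cabs VA <= c0 * Mf.
  apply: le_trans; first exact: cabs_sum.
  apply: (@le_trans _ _ (\sum_(h <- A) c0 * f h)).
    by apply: ler_sum => h _; rewrite cabsM cabs_fourier_basis mulrC ler_wpM2l.
  by rewrite -mulr_sumr ler_wpM2l.
have -> : V * W - VA * WA = (V - VA) * W + VA * (W - WA) by ring.
apply: le_trans (cabs_leD _ _) _; rewrite !cabsM.
have -> : c0 * c0 * (Mf + Mg) * e = (c0 * e) * (c0 * Mg) + (c0 * Mf) * (c0 * e) by ring.
apply: lerD; apply: ler_pM; rewrite ?cabs_ge0//; exact: fourier_series_approx.
Qed.

End FourierSeries.

Section DistributionCoefficients.
Implicit Types (u : torus_distribution R d).

(** The case a = 0 of linearity compares h with g: a distribution does not see
    the proofs carried by a test function. *)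
Lemma pairing_ext u (f g : test_function R d) : (forall x, f x = g x) -> u f = u g.
Proof.
move=> fg; have h1 := @pairing_linear _ _ u 0 g g g.
have h2 := @pairing_linear _ _ u 0 g g f.
rewrite h2; last by move=> x; rewrite mul0r add0r.
by rewrite mul0r add0r.
Qed.

Lemma pairing_scale u (t : R) (f g : test_function R d) :
  (forall x, f x = t * g x) -> u f = t * u g.
Proof.
move=> fg; have h2 := @pairing_linear _ _ u (t - 1) g g f.
by rewrite h2 => [|x]; rewrite ?fg; ring.
Qed.

Lemma dist_coefN u k : dist_coef u (- k) = conjc (dist_coef u k).
Proof.
rewrite /dist_coef conjcM conjc_real; congr (_ * _).
have -> : u (test_cos R (- k)) = u (test_cos R k).
  by apply: pairing_ext => x; rewrite /= /trig phaseN cosN sinN !mul0r.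
have -> : u (test_sin R (- k)) = - 1 * u (test_sin R k).
  by apply: pairing_scale => x; rewrite /= /trig phaseN cosN sinN; ring.
by rewrite mulN1r.
Qed.

Lemma dist_coef_pderiv u r k :
  dist_coef (dist_pderiv r u) k = 'i%C * (k 0 r)%:~R * dist_coef u k.
Proof.
rewrite /dist_coef [in RHS]mulrCA; congr (_ * _) => /=.
have dcos : u (test_pderiv r (test_cos R k)) = - (k 0 r)%:~R * u (test_sin R k).
  apply: pairing_scale => x; rewrite /= /pderiv.
  by rewrite (@derive_val _ _ _ _ _ _ _ (is_derive_trig k 1 0 r x)) /trig; ring.
have dsin : u (test_pderiv r (test_sin R k)) = (k 0 r)%:~R * u (test_cos R k).
  apply: pairing_scale => x; rewrite /= /pderiv.
  by rewrite (@derive_val _ _ _ _ _ _ _ (is_derive_trig k 0 1 r x)) /trig; ring.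
rewrite dcos dsin -(rmorph_int (real_complex R)).
by apply/eqP; rewrite eq_complex/=; apply/andP; split; apply/eqP; ring.
Qed.

End DistributionCoefficients.

End FourierCoefficients.

(** * Boundedness of the function K_{pn} *)

Section BilinearEstimate.
Context (R : realType) (d : nat) (p n : R).
Hypotheses (d_gt0 : (0 < d)%N) (hn : d%:R / 2 < n) (hpn : n <= p).
Local Notation Zd := 'rV[int]_d.
Implicit Types (k h l : Zd) (A B : {fset Zd}).

Lemma n_gt0 : 0 < n.
Proof. by apply: le_lt_trans hn; rewrite divr_ge0. Qed.

Lemma p_gt0 : 0 < p.
Proof. exact: lt_le_trans n_gt0 hpn. Qed.

Lemma powR_sqr (x s : R) : (x `^ s) ^+ 2 = x `^ (2 * s).
Proof. by rewrite -powR_mulrn ?powR_ge0// -powRrM mulrC. Qed.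

Let wden (x y : R) : R := x `^ p * y `^ n + x `^ n * y `^ p.

Let wden_gt0 x y : 0 < x -> 0 < y -> 0 < wden x y.
Proof. by move=> x0 y0; rewrite addr_gt0// mulr_gt0// powR_gt0. Qed.

(** If y <= x, then z^p <= (2x)^p, while the weight contains x^p y^n; the
    quotient is at most a multiple of y^(-2n). *)
Let weight_le (x y z : R) : 0 < x -> 0 < y -> 0 <= z -> z <= x + y ->
  z `^ (2 * p) / wden x y ^+ 2 <=
  2 `^ (2 * p) * (x `^ (- (2 * n)) + y `^ (- (2 * n))).
Proof.
wlog yx : x y / y <= x.
  move=> hw x0 y0 z0 zxy; have [yx|/ltW xy] := leP y x; first exact: hw.
  have -> : wden x y = wden y x by rewrite /wden; ring.
  by rewrite [x `^ _ + _]addrC hw// addrC.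
move=> x0 y0 z0 zxy; have p2 : 0 <= 2 * p by rewrite mulr_ge0// ltW// p_gt0.
have zx : z `^ (2 * p) <= 2 `^ (2 * p) * x `^ (2 * p).
  rewrite -powRM ?(ltW x0)//; apply: ge0_ler_powR => //.
    by rewrite nnegrE mulr_ge0// ltW.
  by rewrite mulr_natl mulr2n; apply: le_trans zxy _; rewrite lerD2l.
rewrite ler_pdivrMr ?exprn_gt0 ?wden_gt0//; apply: le_trans zx _.
rewrite -mulrA ler_pM2l ?powR_gt0//.
apply: (@le_trans _ _ (y `^ (- (2 * n)) * (x `^ p * y `^ n) ^+ 2)).
  rewrite exprMn !powR_sqr mulrCA powRN mulVf ?mulr1//.
  by rewrite gt_eqF// powR_gt0.
apply: ler_pM; rewrite ?powR_ge0 ?sqr_ge0//; first by rewrite lerDr powR_ge0.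
rewrite ler_sqr ?nnegrE ?mulr_ge0 ?powR_ge0 ?(ltW (wden_gt0 _ _))//.
by rewrite lerDl mulr_ge0 ?powR_ge0.
Qed.

Lemma calK_term_ge0 k h : 0 <= calK_term p n k h.
Proof. by rewrite divr_ge0 ?sqr_ge0. Qed.

Let calK_term_le k h : h != 0 -> h != k ->
  knorm R k `^ (2 * p) * calK_term p n k h <=
  2 `^ (2 * p) * (knorm R h `^ (- (2 * n)) + knorm R (k - h) `^ (- (2 * n))).
Proof.
move=> h0 hk; have l0 : k - h != 0 by rewrite subr_eq0 eq_sym.
apply: le_trans; last first.
  apply: (weight_le (z := knorm R k)); rewrite ?knorm_gt0 ?knorm_ge0//.
  by rewrite -{1}(subrK h k) addrC knorm_leD.
rewrite /calK_term ler_wpM2l ?powR_ge0// -[leRHS]mul1r.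
rewrite ler_wpM2r ?invr_ge0 ?sqr_ge0// expr_le1 ?Pnorm_ge0//.
exact: Pnorm_le1.
Qed.

(** The sum defining K(k) is controlled by two lattice sums of |h|^(-2n), one of
    them recentred at k. *)
Lemma calK_bounded : exists C : R, forall k, k != 0 -> (calK p n k <= C%:E)%E.
Proof.
have [C hC] := @lattice_zeta_bounded R d n d_gt0 hn.
exists (4 * (2 `^ (2 * p) * (C + C))) => k k0.
have kp : 0 < knorm R k `^ (2 * p) by rewrite powR_gt0// knorm_gt0.
apply: (@le_trans _ _ ((4 * knorm R k `^ (2 * p))%:E *
    ((2 `^ (2 * p) * (C + C)) / knorm R k `^ (2 * p))%:E)%E); last first.
  by rewrite -EFinM lee_fin mulrACA divff ?gt_eqF// mulr1.
rewrite /calK lee_pmul2l// ?lte_fin ?mulr_gt0//.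
apply: esum_le_of_subsums => A hA; rewrite ler_pdivlMr// mulrC mulr_sumr.
apply: (@le_trans _ _ (\sum_(h <- A) 2 `^ (2 * p) *
    (knorm R h `^ (- (2 * n)) + knorm R (k - h) `^ (- (2 * n))))).
  by apply: ler_sum_fset => h /hA[h0 hk]; apply: calK_term_le => //; exact/eqP.
rewrite -mulr_sumr ler_pM2l ?powR_gt0// big_split/=; apply: lerD.
  by apply: hC => h /hA[].
have -> : \sum_(h <- A) knorm R (k - h) `^ (- (2 * n)) =
    \sum_(l <- [fset k - h | h in A]%fset) knorm R l `^ (- (2 * n)).
  by rewrite big_imfset//= => y z _ _ /addrI/oppr_inj.
apply: hC => l /imfsetP[h /= /hA[_ hk] ->].
by rewrite subr_eq0 eq_sym.
Qed.

End BilinearEstimate.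

(** * The l^2 inequality for finite convolutions *)

Section FiniteSums.
Context (R : realType).

Lemma sum_le_of_unique (I : eqType) (s : seq I) (P : pred I) (z : I) (c : R) :
  uniq s -> 0 <= c -> (forall l, P l -> l = z) -> \sum_(l <- s | P l) c <= c.
Proof.
move=> us c0 Pz; apply: (@le_trans _ _ (\sum_(l <- s | l == z) c)).
  rewrite big_mkcond [leRHS]big_mkcond; apply: ler_sum => l _.
  by case: ifP => [/Pz ->|_]; rewrite ?eqxx//; case: ifP.
rewrite big_const_seq (_ : iter _ _ _ = c *+ count_mem z s).
  by rewrite count_uniq_mem//; case: (_ \in _); rewrite ?mulr1n ?mulr0n.
by elim: (count_mem z s) => // m IH; rewrite iterS IH mulrS.
Qed.

(** Minkowski's inequality in l^2 of a product of index sets, for functions with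
    separated variables: the square expands into products of one-variable sums,
    and Cauchy-Schwarz bounds those of the cross term. *)
Lemma minkowski_product (I : Type) (s : seq I) (P : pred I)
    (a b c e : I -> R) (Na Nb Nc Ne : R) :
  0 <= Na -> 0 <= Nb -> 0 <= Nc -> 0 <= Ne ->
  (forall i, 0 <= a i) -> (forall i, 0 <= b i) ->
  (forall i, 0 <= c i) -> (forall i, 0 <= e i) ->
  \sum_(i <- s | P i) a i ^+ 2 <= Na ^+ 2 -> \sum_(i <- s | P i) b i ^+ 2 <= Nb ^+ 2 ->
  \sum_(i <- s | P i) c i ^+ 2 <= Nc ^+ 2 -> \sum_(i <- s | P i) e i ^+ 2 <= Ne ^+ 2 ->
  \sum_(i <- s | P i) \sum_(j <- s | P j) (a i * b j + c i * e j) ^+ 2 <=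
  (Na * Nb + Nc * Ne) ^+ 2.
Proof.
move=> Na0 Nb0 Nc0 Ne0 a0 b0 c0 e0 aN bN cN eN.
have cs (x y : I -> R) (Nx Ny : R) : 0 <= Nx -> 0 <= Ny ->
    \sum_(i <- s | P i) x i ^+ 2 <= Nx ^+ 2 -> \sum_(i <- s | P i) y i ^+ 2 <= Ny ^+ 2 ->
    \sum_(i <- s | P i) x i * y i <= Nx * Ny.
  move=> Nx0 Ny0 xN yN; apply: le_trans (cauchy_schwarz _ _ _ _) _.
  apply: ler_pM; rewrite ?sqrtr_ge0//.
    by rewrite -[leRHS](ger0_norm Nx0) -sqrtr_sqr ler_wsqrtr.
  by rewrite -[leRHS](ger0_norm Ny0) -sqrtr_sqr ler_wsqrtr.
have -> : \sum_(i <- s | P i) \sum_(j <- s | P j) (a i * b j + c i * e j) ^+ 2 =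
    (\sum_(i <- s | P i) a i ^+ 2) * (\sum_(j <- s | P j) b j ^+ 2) +
    2 * ((\sum_(i <- s | P i) a i * c i) * (\sum_(j <- s | P j) b j * e j)) +
    (\sum_(i <- s | P i) c i ^+ 2) * (\sum_(j <- s | P j) e j ^+ 2).
  rewrite !big_distrlr/= mulr_sumr -!big_split/=; apply: eq_bigr => i _.
  rewrite mulr_sumr -!big_split/=; apply: eq_bigr => j _; ring.
have -> : (Na * Nb + Nc * Ne) ^+ 2 =
  Na ^+ 2 * Nb ^+ 2 + 2 * ((Na * Nc) * (Nb * Ne)) + Nc ^+ 2 * Ne ^+ 2 by ring.
have sq0 (x : I -> R) : 0 <= \sum_(i <- s | P i) x i ^+ 2.
  by apply: sum_ge0_seq => i; exact: sqr_ge0.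
apply: lerD; last exact: ler_pM.
apply: lerD; first exact: ler_pM.
rewrite ler_pM2l//; apply: ler_pM; try exact: cs.
- by apply: sum_ge0_seq => i; exact: mulr_ge0.
- by apply: sum_ge0_seq => i; exact: mulr_ge0.
Qed.

End FiniteSums.

Section ConvolutionEstimate.
Context (R : realType) (d : nat) (p n : R).
Hypotheses (d_gt0 : (0 < d)%N) (hn : d%:R / 2 < n) (hpn : n <= p).
Local Notation Zd := 'rV[int]_d.
Implicit Types (k h l : Zd) (A B : {fset Zd}).

Definition calK_sup : R :=
  fine (ereal_sup [set calK p n k | k in [set k : Zd | k != 0]] : \bar R).

(** Boundedness of K_{pn} is essential here: were the supremum infinite, its
    real part calK_sup would be 0. *)
Lemma calK_le_sup k A : k != 0 -> (forall h, h \in A -> h != 0 /\ h <> k) ->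
  4 * knorm R k `^ (2 * p) * \sum_(h <- A) calK_term p n k h <= calK_sup.
Proof.
move=> k0 hA; have [C hC] := calK_bounded d_gt0 hn hpn.
set E := [set calK p n k | k in [set k : Zd | k != 0]].
have supC : (ereal_sup E <= C%:E)%E.
  by apply: ge_ereal_sup => _ [h /= h0 <-]; exact: hC.
have Kk : (calK p n k <= ereal_sup E)%E by apply: ereal_sup_ubound; exists k.
have le1 : ((4 * knorm R k `^ (2 * p) * \sum_(h <- A) calK_term p n k h)%:E <= calK p n k)%E.
  rewrite EFinM /calK lee_pmul2l ?lte_fin ?mulr_gt0 ?powR_gt0 ?knorm_gt0//.
  apply: subsum_le_esum => h /hA[h0 /eqP hk]; split=> //; exact/eqP.
have le2 := le_trans le1 Kk.
have supfin : ereal_sup E \is a fin_num.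
  rewrite fin_numE; apply/andP; split.
    by apply: contraTneq le2 => ->; rewrite leeNy_eq.
  by apply: contraTneq supC => ->; rewrite leye_eq.
by rewrite -lee_fin /calK_sup fineK.
Qed.

Lemma KplusE : Kplus d p n = basis_norm R d * Num.sqrt calK_sup.
Proof. by []. Qed.

Lemma calK_sup_ge0 : 0 <= calK_sup.
Proof.
pose k : Zd := \row__ 1.
have k0 : k != 0.
  by apply/eqP => /rowP/(_ (Ordinal d_gt0)); rewrite !mxE => /eqP; rewrite oner_eq0.
have := @calK_le_sup k fset0 k0; rewrite big_seq_fset0 mulr0; apply.
by move=> h.
Qed.

Context (V W : Zd -> 'rV[R[i]]_d).
Hypotheses (divV : forall k, cdot (cvec R k) (V k) = 0)
  (divW : forall k, cdot (cvec R k) (W k) = 0) (V0 : V 0 = 0) (W0 : W 0 = 0).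

(** Up to a scalar, the k-th coefficient of the product v . dw of the partial
    sums over A, before projection. *)
Definition convolution A k : 'rV[R[i]]_d :=
  \sum_(h <- A) \sum_(l <- A | h + l == k) cdot (V h) (cvec R l) *: W l.

Let pairs A := [seq (h, l) | h <- A, l <- A].
Let admissible (q : Zd * Zd) := (q.1 != 0) && (q.2 != 0).
Let den (q : Zd * Zd) : R := (knorm R q.1) `^ p * (knorm R q.2) `^ n +
  (knorm R q.1) `^ n * (knorm R q.2) `^ p.
Let magnitude (q : Zd * Zd) : R := cnorm (V q.1) * knorm R q.2 * cnorm (W q.2).

Let cnorm_convolution_le A k :
  cnorm (leray k (convolution A k)) <=
  \sum_(q <- pairs A | admissible q && (q.1 + q.2 == k))
    Pnorm R q.1 q.2 * magnitude q.
Proof.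
have -> : convolution A k =
    \sum_(q <- pairs A | admissible q && (q.1 + q.2 == k))
       cdot (V q.1) (cvec R q.2) *: W q.2.
  rewrite big_mkcond big_allpairs_dep/=; apply: eq_bigr => h _.
  rewrite big_mkcond; apply: eq_bigr => l _; rewrite /admissible/=.
  have [->|h0] := eqVneq h 0; first by rewrite V0 cdot0l scale0r if_same.
  by have [->|l0] := eqVneq l 0; first by rewrite W0 scaler0 if_same.
rewrite leray_sum; apply: le_trans; first exact: cnorm_sum.
apply: ler_sum => -[h l] /= /andP[/andP[h0 l0] /eqP <-].
have lp : knorm R l != 0 by rewrite gt_eqF// knorm_gt0.
have -> : leray (h + l) (cdot (V h) (cvec R l) *: W l) =
    (knorm R l)%:C *: Pmap h l (V h) (W l).
  rewrite lerayZ /Pmap scalerA; congr (_ *: _).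
  rewrite mulrCA divff ?mulr1// -(rmorph0 (real_complex R)).
  by rewrite (inj_eq (@complexI R)).
rewrite cnormZ cabs_real ger0_norm ?knorm_ge0//.
have := @Pmap_le R d h l (V h) (W l) (mem_set (divV h)) (mem_set (divW l)) => Ple.
rewrite /magnitude/=; have := ler_wpM2l (knorm_ge0 R l) Ple.
by move/le_trans; apply; rewrite le_eqVlt; apply/orP; left; apply/eqP; ring.
Qed.

(** The pairs with sum k are determined by their first component. *)
Let calK_sum_le A k : k != 0 ->
  4 * knorm R k `^ (2 * p) *
  (\sum_(q <- pairs A | admissible q && (q.1 + q.2 == k))
    (Pnorm R q.1 q.2 / den q) ^+ 2) <= calK_sup.
Proof.
move=> k0; apply: le_trans (@calK_le_sup k [fset h in A | (h != 0) && (h != k)]%fset k0 _).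
  rewrite ler_wpM2l ?mulr_ge0 ?powR_ge0//.
  rewrite big_mkcond big_allpairs_dep/= -big_fset_condE/= [leRHS]big_mkcond/=.
  apply: ler_sum => h _; rewrite -big_mkcond/= /admissible/=.
  case: ifP => [_|/negP hN]; last first.
    rewrite big1// => l /andP[/andP[h0 l0] /eqP hlk]; case: hN.
    by rewrite h0/= -hlk -subr_eq0 opprD addNKr oppr_eq0.
  apply: le_trans (sum_le_of_unique (fset_uniq A) (calK_term_ge0 p n k h) (z := k - h) _).
    apply: ler_sum => l /andP[_ /eqP <-].
    by rewrite /calK_term [h + l]addrC addrK expr_div_n.
  by move=> l /andP[_ /eqP <-]; rewrite [h + l]addrC addrK.
by move=> h; rewrite !inE => /andP[_ /andP[h0 /eqP hk]].
Qed.

Context (Na Nb Nc Ne : R).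
Hypotheses (Na0 : 0 <= Na) (Nb0 : 0 <= Nb) (Nc0 : 0 <= Nc) (Ne0 : 0 <= Ne).
Let bounded_norm (m : R) (U : Zd -> 'rV[R[i]]_d) (N : R) :=
  forall A, (forall k, k \in A -> k != 0) ->
    \sum_(k <- A) knorm R k `^ (2 * m) * cnorm (U k) ^+ 2 <= N ^+ 2.
Hypotheses (VNa : bounded_norm p V Na) (WNb : bounded_norm (n + 1) W Nb)
  (VNc : bounded_norm n V Nc) (WNe : bounded_norm (p + 1) W Ne).

(** Cauchy-Schwarz over the pairs with sum k, against the weight
    |h|^p |l|^n + |h|^n |l|^p, separates the constant from the data; summing over
    k then removes the constraint on the sum of the pair. *)
Lemma convolution_estimate A B : (forall k, k \in B -> k != 0) ->
  \sum_(k <- B) knorm R k `^ (2 * p) * cnorm (leray k (convolution A k)) ^+ 2 <=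
  calK_sup / 4 * (Na * Nb + Nc * Ne) ^+ 2.
Proof.
move=> B0.
have K4 : 0 <= calK_sup / 4 by rewrite divr_ge0 ?calK_sup_ge0.
have den_gt0 q : admissible q -> 0 < den q.
  by case/andP => q1 q2; rewrite addr_gt0// mulr_gt0// powR_gt0// knorm_gt0.
have one k : k != 0 ->
    knorm R k `^ (2 * p) * cnorm (leray k (convolution A k)) ^+ 2 <=
    calK_sup / 4 * \sum_(q <- pairs A | admissible q && (q.1 + q.2 == k))
      (den q * magnitude q) ^+ 2.
  move=> k0; have le1 := cnorm_convolution_le A k.
  have le2 := cauchy_schwarz_sqr (pairs A)
    (fun q => admissible q && (q.1 + q.2 == k))
    (fun q => Pnorm R q.1 q.2 / den q) (fun q => den q * magnitude q).
  have s0 := le_trans (cnorm_ge0 _) le1.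
  have {}le1 := lerXn2r 2 (cnorm_ge0 _) s0 le1.
  have eqs : \sum_(q <- pairs A | admissible q && (q.1 + q.2 == k))
       Pnorm R q.1 q.2 * magnitude q =
     \sum_(q <- pairs A | admissible q && (q.1 + q.2 == k))
       Pnorm R q.1 q.2 / den q * (den q * magnitude q).
    apply: eq_bigr => q /andP[/den_gt0 q0 _].
    by rewrite mulrA divfK// gt_eqF.
  rewrite eqs in le1; have {le1 le2 eqs} := le_trans le1 le2.
  have := calK_sum_le A k0; set X := \sum_(q <- _ | _) _ => hX.
  set Y := \sum_(q <- _ | _) _.
  have Y0 : 0 <= Y by apply: sum_ge0_seq => q; exact: sqr_ge0.
  move=> hT; have kp : 0 <= knorm R k `^ (2 * p) by exact: powR_ge0.
  apply: le_trans (ler_wpM2l kp hT) _; rewrite mulrA ler_wpM2r//; lra.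
apply: (@le_trans _ _ (\sum_(k <- B) calK_sup / 4 *
    \sum_(q <- pairs A | admissible q && (q.1 + q.2 == k)) (den q * magnitude q) ^+ 2)).
  by apply: ler_sum_fset => k /B0; exact: one.
rewrite -mulr_sumr ler_wpM2l//.
rewrite (exchange_big_dep admissible)/=; last by move=> k q _ /andP[].
apply: (@le_trans _ _ (\sum_(q <- pairs A | admissible q) (den q * magnitude q) ^+ 2)).
  apply: ler_sum => q aq; rewrite aq/=.
  apply: (sum_le_of_unique (fset_uniq B) (sqr_ge0 _) (z := q.1 + q.2)).
  by move=> k /eqP.
pose al h := knorm R h `^ p * cnorm (V h); pose be h := knorm R h `^ (n + 1) * cnorm (W h).
pose ga h := knorm R h `^ n * cnorm (V h); pose de h := knorm R h `^ (p + 1) * cnorm (W h).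
have -> : \sum_(q <- pairs A | admissible q) (den q * magnitude q) ^+ 2 =
    \sum_(h <- A | h != 0) \sum_(l <- A | l != 0) (al h * be l + ga h * de l) ^+ 2.
  rewrite big_mkcond big_allpairs_dep/= [RHS]big_mkcond/=; apply: eq_bigr => h _.
  rewrite -big_mkcond/= /admissible/=; case: (h != 0) => /=; last by rewrite big_pred0.
  apply: eq_bigr => l l0; congr (_ ^+ 2).
  have lp : knorm R l != 0 by rewrite gt_eqF// knorm_gt0.
  have expand (x y x' y' a c e : R) :
      (x * y + x' * y') * (a * c * e) = x * a * (y * c * e) + x' * a * (y' * c * e).
    by ring.
  rewrite /al /be /ga /de /den /magnitude/= !powRD ?lp ?implybT// powRr1 ?knorm_ge0//.
have fold m (U : Zd -> 'rV[R[i]]_d) N : bounded_norm m U N ->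
    \sum_(h <- A | h != 0) (knorm R h `^ m * cnorm (U h)) ^+ 2 <= N ^+ 2.
  move=> hU; rewrite big_fset_condE/=; under eq_bigr do rewrite exprMn powR_sqr.
  by apply: hU => k; rewrite !inE => /andP[].
have nn m (U : Zd -> 'rV[R[i]]_d) h : 0 <= knorm R h `^ m * cnorm (U h).
  by rewrite mulr_ge0 ?powR_ge0 ?cnorm_ge0.
apply: minkowski_product => //; first [exact: fold|by move=> h; exact: nn].
Qed.

End ConvolutionEstimate.

(** * Sobolev norms and absolute summability *)

Section SobolevSums.
Context (R : realType) (d : nat).
Local Notation Zd := 'rV[int]_d.
Implicit Types (k h l : Zd) (A B : {fset Zd}) (v w : vdistribution R d).

Lemma sobolev_term_ge0 (m : R) v k :
  0 <= knorm R k `^ (2 * m) * cnorm (vcoef v k) ^+ 2.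
Proof. by rewrite mulr_ge0 ?powR_ge0 ?sqr_ge0. Qed.

Lemma sobolev_sqnorm_ge0 (m : R) v : (0 <= sobolev_sqnorm m v)%E.
Proof. by apply: esum_ge0 => k _; rewrite lee_fin sobolev_term_ge0. Qed.

Lemma sobolev_norm_ge0 (m : R) v : 0 <= sobolev_norm m v.
Proof. exact: sqrtr_ge0. Qed.

Lemma sobolev_norm_sqr (m : R) v :
  sobolev_norm m v ^+ 2 = fine (sobolev_sqnorm m v).
Proof. by rewrite sqr_sqrtr// fine_ge0// sobolev_sqnorm_ge0. Qed.

Lemma sobolev_sqnorm_mono (m m' : R) v : m <= m' ->
  (sobolev_sqnorm m' v < +oo)%E -> (sobolev_sqnorm m v < +oo)%E.
Proof.
move=> mm'; apply: le_lt_trans; apply: le_esum => k /= k0.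
rewrite lee_fin ler_wpM2r ?sqr_ge0// ler_powR ?ler_wpM2l//.
by apply: knorm_ge1; apply/eqP; move/eqP: k0.
Qed.

Lemma sobolev_subsum_le (m : R) v A : (sobolev_sqnorm m v < +oo)%E ->
  (forall k, k \in A -> k != 0) ->
  \sum_(k <- A) knorm R k `^ (2 * m) * cnorm (vcoef v k) ^+ 2 <= sobolev_norm m v ^+ 2.
Proof.
move=> voo A0; rewrite sobolev_norm_sqr; apply: subsum_le_fine_esum => //.
by move=> k _; exact: sobolev_term_ge0.
Qed.

(** Cauchy-Schwarz against |k|^(-m), which is square summable for m > d/2. *)
Lemma weighted_l2_bounded_subsums (m N : R) (f : Zd -> R) :
  (0 < d)%N -> d%:R / 2 < m -> (forall k, 0 <= f k) -> f 0 = 0 ->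
  (forall A, (forall k, k \in A -> k != 0) ->
     \sum_(k <- A) knorm R k `^ (2 * m) * f k ^+ 2 <= N ^+ 2) ->
  has_bounded_subsums f.
Proof.
move=> d0 dm f0 f00 fN; have [C hC] := @lattice_zeta_bounded R d m d0 dm.
exists (Num.sqrt C * `|N|) => A.
pose A' := [fset k in A | k != 0]%fset.
have A'0 k : k \in A' -> k != 0 by rewrite !inE => /andP[].
have -> : \sum_(k <- A) f k =
    \sum_(k <- A') knorm R k `^ (- m) * (knorm R k `^ m * f k).
  rewrite -big_fset_condE/= [RHS]big_mkcond/=.
  apply: eq_bigr => k _; case: eqVneq => [->//|k0] /=.
  by rewrite mulrA powRN mulVf ?mul1r// gt_eqF// powR_gt0// knorm_gt0.
apply: le_trans (cauchy_schwarz _ _ _ _) _; apply: ler_pM; rewrite ?sqrtr_ge0//.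
  rewrite ler_wsqrtr//; under eq_bigr do rewrite powR_sqr mulrN.
  exact: hC.
rewrite -sqrtr_sqr ler_wsqrtr//; under eq_bigr do rewrite exprMn powR_sqr.
exact: fN.
Qed.

End SobolevSums.

Lemma sqr_le_of_close (R : realDomainType) (z a q : R) :
  0 <= z -> 0 <= a -> 0 < q -> z <= q + a -> z ^+ 2 <= a ^+ 2 + q * (2 * z).
Proof.
move=> z0 a0 q0 zqa; have [zq|qz] := leP z q; first by nra.
have : (z - q) ^+ 2 <= a ^+ 2 by rewrite ler_sqr ?nnegrE//; lra.
nra.
Qed.

(** * The coefficients of P(v, w) *)

Section Advection.
Context (R : realType) (d : nat) (p n : R).
Hypotheses (d_gt0 : (0 < d)%N) (hn : d%:R / 2 < n) (hpn : n <= p).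
Local Notation Zd := 'rV[int]_d.
Implicit Types (k h l : Zd) (A B : {fset Zd}).

Context (v w : vdistribution R d).
Hypotheses (vS : sobolev p v) (wS : sobolev (p + 1) w).
Local Notation c0 := (basis_norm R d).

Let hp : d%:R / 2 < p. Proof. exact: lt_le_trans hn hpn. Qed.

Let V0 : vcoef v 0 = 0. Proof. by case: vS. Qed.
Let W0 : vcoef w 0 = 0. Proof. by case: wS. Qed.

Let f k : R := cnorm (vcoef v k).
Let g k : R := knorm R k * cnorm (vcoef w k).

Let f_ge0 k : 0 <= f k. Proof. exact: cnorm_ge0. Qed.
Let g_ge0 k : 0 <= g k. Proof. by rewrite mulr_ge0 ?cnorm_ge0 ?knorm_ge0. Qed.

Let f_bounded : has_bounded_subsums f.
Proof.
apply: (@weighted_l2_bounded_subsums _ _ p (sobolev_norm p v)) => //.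
  by rewrite /f V0 cnorm0.
by move=> A A0; apply: sobolev_subsum_le => //; case: vS.
Qed.

Let g_bounded : has_bounded_subsums g.
Proof.
apply: (@weighted_l2_bounded_subsums _ _ p (sobolev_norm (p + 1) w)) => //.
  by rewrite /g W0 cnorm0 mulr0.
move=> A A0.
have woo : (sobolev_sqnorm (p + 1) w < +oo)%E by case: wS.
apply: le_trans (sobolev_subsum_le woo A0); apply: ler_sum_fset => k /A0 k0.
have kp : knorm R k != 0 by rewrite gt_eqF// knorm_gt0.
rewrite /g exprMn mulrA mulrDr powRD ?kp ?implybT// mulr1 powR_mulrn//.
exact: knorm_ge0.
Qed.

Let v_le r k : cabs (dist_coef (v r) k) <= f k.
Proof. by have := cabs_le_cnorm (vcoef v k) r; rewrite mxE. Qed.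

Let dw_le r s k : cabs (dist_coef (dist_pderiv r (w s)) k) <= g k.
Proof.
rewrite dist_coef_pderiv 2!cabsM.
have -> : cabs ('i%C : R[i]) = 1 by rewrite /= expr0n expr1n add0r sqrtr1.
rewrite mul1r; apply: ler_pM; rewrite ?cabs_ge0//.
  rewrite -(rmorph_int (real_complex R)) cabs_real; exact: normr_coord_le_knorm.
by have := cabs_le_cnorm (vcoef w k) s; rewrite mxE.
Qed.

Lemma bounded_measurable_advection s : bounded_measurable (advection v w s).
Proof.
apply: bounded_measurable_sum => r; apply: bounded_measurableM.
  exact: (bounded_measurable_series (v_le r) f_bounded).
exact: (bounded_measurable_series (dw_le r s) g_bounded).
Qed.

Lemma advection_real s x : complex.Im (advection v w s x) = 0.
Proof.
rewrite /advection; elim/big_ind : _ => [//|a b a0 b0|r _].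
  by rewrite ImD a0 b0 addr0.
rewrite ImM (_ : complex.Im (dist_fun (v r) x) = 0); last first.
  apply: (fourier_series_real (v_le r) f_bounded) => k; exact: dist_coefN.
rewrite (_ : complex.Im (dist_fun _ x) = 0) ?mulr0 ?mul0r ?addr0//.
apply: (fourier_series_real (dw_le r s) g_bounded) => k; exact: dist_coefN.
Qed.

Lemma advection_coef_approx : exists2 K : R, 0 <= K &
  forall A e, tail_le f A e -> tail_le g A e -> forall k s,
  cabs (fun_coef (advection v w s) k -
    (c0%:C * 'i%C) * (convolution (vcoef v) (vcoef w) A k) 0 s) <= K * e.
Proof.
have [Mf fM] := f_bounded; have [Mg gM] := g_bounded.
have Mf0 : 0 <= Mf by have := fM fset0; rewrite big_seq_fset0.
have Mg0 : 0 <= Mg by have := gM fset0; rewrite big_seq_fset0.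
have c00 : 0 <= c0 by rewrite ltW// basis_norm_gt0.
exists (\sum_(r < d) coef_bound R d * (c0 * c0 * (Mf + Mg))).
  apply: sumr_ge0 => r _; apply: mulr_ge0; first exact: coef_bound_ge0.
  by rewrite mulr_ge0 ?addr_ge0// mulr_ge0.
move=> A e fA gA k s.
have -> : fun_coef (advection v w s) k = \sum_(r < d) fun_coef
    (fun x => fourier_series (dist_coef (v r)) x *
              fourier_series (dist_coef (dist_pderiv r (w s))) x) k.
  rewrite -fun_coef_sum; first by [].
  move=> r; apply: bounded_measurableM.
    exact: (bounded_measurable_series (v_le r) f_bounded).
  exact: (bounded_measurable_series (dw_le r s) g_bounded).
have -> : (c0%:C * 'i%C) * (convolution (vcoef v) (vcoef w) A k) 0 s =
    \sum_(r < d) c0%:C * \sum_(h <- A) \sum_(l <- A | h + l == k)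
      dist_coef (v r) h * dist_coef (dist_pderiv r (w s)) l.
  rewrite -mulr_sumr -mulrA; congr (_ * _).
  rewrite exchange_big/= /convolution summxE mulr_sumr; apply: eq_bigr => h _.
  rewrite exchange_big/= summxE mulr_sumr; apply: eq_bigr => l _.
  rewrite !mxE /cdot mulr_suml mulr_sumr; apply: eq_bigr => r _.
  by rewrite dist_coef_pderiv !mxE; ring.
rewrite -sumrB; apply: le_trans; first exact: cabs_sum.
rewrite mulr_suml; apply: ler_sum => r _; rewrite -mulrA.
exact: (fun_coef_seriesM_approx k (v_le r) (dw_le r s) fM gM fA gA).
Qed.

Definition NS_coef k : 'rV[R[i]]_d := leray k (\row_s fun_coef (advection v w s) k).

(** The error of the finite convolutions is uniform in k, and projecting does not
    increase it. *)
Lemma NS_coef_approx (e : R) : 0 < e -> exists A, forall k,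
  cnorm (NS_coef k - leray k ((c0%:C * 'i%C) *:
    convolution (vcoef v) (vcoef w) A k)) <= e.
Proof.
move=> e0; have [K K0 hK] := advection_coef_approx.
pose q := e / (d%:R * K + 1).
have D0 : 0 < d%:R * K + 1 by rewrite ltr_wpDl// mulr_ge0.
have q0 : 0 < q by rewrite divr_gt0.
have [A1 fA1] := exists_tail_le f_ge0 f_bounded q0.
have [A2 gA2] := exists_tail_le g_ge0 g_bounded q0.
exists (A1 `|` A2)%fset => k.
have fA := tail_le_subset (fsubsetUl A1 A2) fA1.
have gA := tail_le_subset (fsubsetUr A1 A2) gA2.
rewrite /NS_coef -scaleN1r -lerayZ -lerayD; apply: le_trans (cnorm_leray_le _ _) _.
apply: le_trans (cnorm_le_sum _) _.
apply: (@le_trans _ _ (\sum_(s < d) K * q)).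
  apply: ler_sum => s _; have := hK _ _ fA gA k s.
  by rewrite 4!mxE mulN1r.
rewrite sumr_const card_ord -mulr_natl /q mulrA mulrCA ler_piMr ?ltW//.
by rewrite ltr_pdivrMr// mul1r ltrDl.
Qed.

Lemma cdot_NS_coef k : cdot (cvec R k) (NS_coef k) = 0.
Proof. exact: cdot_leray. Qed.

(** In each finite convolution at k = 0 the terms carry the factor
    v_h . (-h), which vanishes because v has zero divergence. *)
Lemma NS_coef0 : NS_coef 0 = 0.
Proof.
apply: cnorm_eq0; apply/eqP; rewrite eq_le cnorm_ge0 andbT.
apply/ler_addgt0Pr => e e0; rewrite add0r.
have [A hA] := NS_coef_approx e0; apply: le_trans (hA 0).
rewrite (_ : convolution _ _ A 0 = 0) ?scaler0 ?leray0r ?subr0//.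
apply: big1 => h _; apply: big1 => l; rewrite addrC addr_eq0 => /eqP ->.
have [divV _ _] := vS.
by rewrite cvecN -scaleN1r cdotZr cdotC divV mulr0 scale0r.
Qed.

Lemma NS_coefN k : NS_coef (- k) = map_mx conjc (NS_coef k).
Proof.
rewrite /NS_coef -lerayJ; congr leray; apply/rowP => s; rewrite !mxE.
by apply: fun_coefJ; [exact: bounded_measurable_advection|exact: advection_real].
Qed.

Let bound : R := 2^-1 * Kplus d p n *
  (sobolev_norm p v * sobolev_norm (n + 1) w + sobolev_norm n v * sobolev_norm (p + 1) w).

Lemma bound_ge0 : 0 <= bound.
Proof.
rewrite /bound KplusE mulr_ge0//.
  by rewrite mulr_ge0// mulr_ge0 ?sqrtr_ge0// ltW// basis_norm_gt0.
by rewrite addr_ge0// mulr_ge0 ?sobolev_norm_ge0.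
Qed.

(** The bound on finite convolutions does not depend on the set of frequencies,
    so it survives the limit: if z = |u_k| satisfies z <= a + q, where a bounds the
    approximant, then z^2 <= a^2 + 2 q z, and the total error 2 q z over B is made
    smaller than e. *)
Lemma NS_coef_subsum_le B : (forall k, k \in B -> k != 0) ->
  \sum_(k <- B) knorm R k `^ (2 * p) * cnorm (NS_coef k) ^+ 2 <= bound ^+ 2.
Proof.
move=> B0; have [divV _ voo] := vS; have [divW _ woo] := wS.
pose T := \sum_(k <- B) knorm R k `^ (2 * p) * (2 * cnorm (NS_coef k)).
have T0 : 0 <= T.
  by apply: sum_ge0_seq => k; rewrite !mulr_ge0 ?powR_ge0 ?cnorm_ge0.
apply/ler_addgt0Pr => e e0.
pose q := e / (T + 1).
have D0 : 0 < T + 1 by rewrite ltr_wpDl.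
have q0 : 0 < q by rewrite divr_gt0.
have [A hA] := NS_coef_approx q0.
pose C k := convolution (vcoef v) (vcoef w) A k.
have est : \sum_(k <- B) knorm R k `^ (2 * p) * cnorm (leray k (C k)) ^+ 2 <=
    calK_sup d p n / 4 * (sobolev_norm p v * sobolev_norm (n + 1) w +
     sobolev_norm n v * sobolev_norm (p + 1) w) ^+ 2.
  apply: convolution_estimate => //; try exact: sobolev_norm_ge0.
  - by move=> S; exact: sobolev_subsum_le.
  - move=> S; apply: sobolev_subsum_le; apply: sobolev_sqnorm_mono woo.
    by rewrite lerD2r.
  - by move=> S; apply: sobolev_subsum_le; apply: sobolev_sqnorm_mono voo.
  - by move=> S; exact: sobolev_subsum_le.
have one k : cnorm (NS_coef k) ^+ 2 <=
    c0 ^+ 2 * cnorm (leray k (C k)) ^+ 2 + q * (2 * cnorm (NS_coef k)).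
  have := hA k; rewrite lerayZ => hk.
  set z := cnorm (NS_coef k); set a := cnorm (leray k (C k)).
  have za : z <= q + c0 * a.
    have ca : cnorm ((c0%:C * 'i%C) *: leray k (C k)) = c0 * a.
      rewrite cnormZ cabsM cabs_real gtr0_norm ?basis_norm_gt0//.
      have -> : cabs ('i%C : R[i]) = 1 by rewrite /= expr0n expr1n add0r sqrtr1.
      by rewrite mulr1.
    rewrite /z -(subrK ((c0%:C * 'i%C) *: leray k (C k)) (NS_coef k)).
    by apply: le_trans (cnorm_leD _ _) _; rewrite ca lerD2r.
  have z0 : 0 <= z by exact: cnorm_ge0.
  have a0 : 0 <= c0 * a by rewrite mulr_ge0 ?cnorm_ge0 ?ltW ?basis_norm_gt0.
  by rewrite -exprMn; exact: sqr_le_of_close.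
apply: (@le_trans _ _ (c0 ^+ 2 * (\sum_(k <- B) knorm R k `^ (2 * p) *
    cnorm (leray k (C k)) ^+ 2) + q * T)).
  rewrite /T !mulr_sumr -big_split/=; apply: ler_sum => k _.
  apply: le_trans (ler_wpM2l (powR_ge0 _ _) (one k)) _.
  have comb (x y z t u : R) : x * (y * z + t * u) = y * (x * z) + t * (x * u) by ring.
  by rewrite comb.
apply: lerD; last first.
  by rewrite /q mulrAC ler_pdivrMr// ler_wpM2l ?(ltW e0)// lerDl.
apply: le_trans (ler_wpM2l (sqr_ge0 c0) est) _.
have regroup (x s z : R) : x ^+ 2 * (s ^+ 2 / 4 * z ^+ 2) = (2^-1 * (x * s) * z) ^+ 2.
  by field.
rewrite /bound KplusE -[X in X / 4](@sqr_sqrtr _ (calK_sup d p n)) ?regroup//.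
exact: calK_sup_ge0.
Qed.

End Advection.

(** * Distributions with prescribed absolutely summable coefficients *)

Section TestFunctions.
Context (R : realType) (d : nat).
Local Notation Zd := 'rV[int]_d.
Local Notation mR := (measurableTypeR R).
Local Notation mT := (d.-tuple mR).
Implicit Types (x : 'rV[R]_d) (phi : test_function R d).

Let measurable_floor_cell (N : nat) (z : int) :
  measurable ([set x : mR | Num.floor (N.+1%:R * x) = z]).
Proof.
have N0 : 0 < N.+1%:R :> R by rewrite ltr0n.
rewrite (_ : [set x | _] = [set` `[z%:~R / N.+1%:R, (z + 1)%:~R / N.+1%:R[ ]).
  exact: measurable_itv.
apply/seteqP; split => x /=; rewrite in_itv/= ler_pdivrMr// ltr_pdivlMr// [x * _]mulrC.
  by move=> <-; exact: floor_itv.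
exact: floor_def.
Qed.

(** A continuous function is the pointwise limit of its values at the lower
    corners of ever finer cubic cells; each of these step functions takes
    countably many values, on measurable boxes. *)
Lemma measurable_continuous (phi : 'rV[R]_d -> R) : continuous phi ->
  measurable_fun setT (fun t : mT => phi (\row_r tnth t r)).
Proof.
move=> cphi.
pose cell (N : nat) (t : mT) : Zd := \row_r Num.floor (N.+1%:R * tnth t r).
pose G (N : nat) (k : Zd) : R := phi (\row_r ((k 0 r)%:~R / N.+1%:R)).
apply: (measurable_fun_cvg (h := fun N t => G N (cell N t))).
  move=> N _ Y mY; rewrite setTI.
  have -> : (fun t => G N (cell N t)) @^-1` Y =
      \bigcup_(k in [set: Zd]) ([set t | Y (G N k) /\ cell N t = k]).
    apply/seteqP; split => [t /= Yt|t [k _ /= [Yk ->]]//].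
    by exists (cell N t).
  apply: countable_bigcupT_measurable => [|k]; first exact: countableP.
  have [Yk|nYk] := pselect (Y (G N k)); last first.
    by rewrite (_ : [set t | _] = set0)//; apply/seteqP; split => t //= [].
  rewrite (_ : [set t | _] = \bigcap_(r in [set: 'I_d])
     ((@tnth d R ^~ r) @^-1` [set x : mR | Num.floor (N.+1%:R * x) = k 0 r])).
    apply: fin_bigcap_measurable => // r _.
    have := @measurable_tnth _ mR d r measurableT _ (measurable_floor_cell N (k 0 r)).
    by rewrite setTI.
  apply/seteqP; split => [t /= [_ <-] r _|t h]; first by rewrite /= mxE.
  by split=> //; apply/rowP => r; rewrite mxE; exact: h.
move=> t _; set x := \row_r tnth t r.
apply/cvg_ballP => e e0.
have /nbhs_ballP[dl /= dl0 hdl] : nbhs x (phi @^-1` (ball (phi x) e)).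
  by apply: cphi; exact: nbhsx_ballx.
exists `|Num.ceil dl^-1|%N => // N /= hN; apply: hdl; split=> // i r.
rewrite /x !mxE; set y := tnth t r.
have N0 : 0 < N.+1%:R :> R by rewrite ltr0n.
have /andP[h1 h2] := floor_itv (N.+1%:R * y).
rewrite /ball/= ltr_norml.
have Nd : N.+1%:R^-1 <= dl.
  rewrite invf_ple ?posrE//; apply: le_trans (ceil_ge _) _; apply: le_trans (ler_norm _) _.
  by rewrite -intr_norm -natr_absz ler_nat leqW.
have lo : (Num.floor (N.+1%:R * y))%:~R / N.+1%:R <= y by rewrite ler_pdivrMr// [y * _]mulrC.
have hi : y < (Num.floor (N.+1%:R * y))%:~R / N.+1%:R + N.+1%:R^-1.
  by rewrite -[X in _ + X]mul1r -mulrDl ltr_pdivlMr// [y * _]mulrC -intrD1.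
have close (a b m c : R) : 0 < c -> b <= a -> a < b + m -> m <= c -> - c < a - b < c.
  by move=> *; apply/andP; split; lra.
exact: close dl0 lo hi Nd.
Qed.

Let periodicz phi r (z : int) x :
  phi (x + ((2 * pi) *: basis_vec R r) *~ z) = phi x.
Proof.
case: z => m; first by rewrite -pmulrn (periodicn (@test_periodic _ _ phi r)).
by rewrite NegzE mulrNz -pmulrn -(periodicn (@test_periodic _ _ phi r) m.+1) subrK.
Qed.

(** Translating by multiples of 2pi in each coordinate moves any point into the
    compact cube of side 2pi. *)
Lemma test_function_bounded phi : exists M, forall x, `|phi x| <= M.
Proof.
pose Q := [set y : 'rV[R]_d | forall r, `[0, 2 * pi]%classic (y ord0 r)].
have cQ : compact Q.
  exact: (@rV_compact R d (fun _ => `[0, 2 * pi]%classic)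
    (fun _ => @segment_compact R 0 (2 * pi))).
have cphi : continuous phi := (@test_smooth _ _ phi [::]).1.
have cphiQ : compact (phi @` Q).
  exact: (continuous_compact (continuous_subspaceT cphi) cQ).
have [M [_ hM]] := @compact_bounded R R _ cphiQ.
have shift (z : 'I_d -> int) x :
    phi (x + \sum_(r < d) ((2 * pi) *: basis_vec R r) *~ z r) = phi x.
  elim/big_ind : _ x => [x|a b ha hb x|r _ x].
  - by rewrite addr0.
  - by rewrite addrA hb ha.
  - exact: periodicz.
exists (M + 1) => x.
pose z r := Num.floor (x 0 r / (2 * pi)).
pose y := x + \sum_(r < d) ((2 * pi) *: basis_vec R r) *~ (- z r).
have <- : phi y = phi x by exact: shift.
have p0 := pi2_gt0 R.
apply: (hM (M + 1)); first by rewrite ltrDl.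
exists y => // r; rewrite /y /= in_itv/= mxE summxE (bigD1 r)//= big1 ?addr0; last first.
  by move=> q qr; rewrite -scaler_int !mxE eqxx/= eq_sym (negPf qr) !mulr0.
rewrite -scaler_int !mxE !eqxx/= mulr1.
have /andP[h1 h2] := floor_itv (x 0 r / (2 * pi)).
rewrite -/(z r) in h1 h2; rewrite rmorphN mulNr.
move: h1 h2; rewrite ler_pdivlMr// ltr_pdivrMr// intrD1 mulrDl mul1r => h1 h2.
by apply/andP; split; lra.
Qed.

Lemma bounded_measurable_test phi : bounded_measurable (fun x => (phi x)%:C).
Proof.
split; last by have [M hM] := test_function_bounded phi; exists M => x; rewrite cabs_real.
  exact: measurable_continuous (@test_smooth _ _ phi [::]).1.
exact: measurable_cst.
Qed.

End TestFunctions.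

Section RegularDistribution.
Context (R : realType) (d : nat).
Local Notation Zd := 'rV[int]_d.
Context (F : 'rV[R]_d -> R[i]) (bF : bounded_measurable F).
Hypothesis F_real : forall x, complex.Im (F x) = 0.

Let bFphi (phi : test_function R d) : bounded_measurable (fun x => F x * (phi x)%:C).
Proof. by apply: bounded_measurableM => //; exact: bounded_measurable_test. Qed.

Let torus_integral_real (G : 'rV[R]_d -> R[i]) : bounded_measurable G ->
  (forall x, complex.Im (G x) = 0) -> complex.Im (torus_integral G) = 0.
Proof.
move=> bG G0; have := torus_integralJ bG.
rewrite (_ : (fun x => conjc (G x)) = G); last first.
  by apply/funext => x; case: (G x) (G0 x) => a b /= ->; rewrite oppr0.
case: (torus_integral G) => u v /= [] /eqP.
by rewrite -addr_eq0 -mulr2n mulrn_eq0/= => /eqP.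
Qed.

Let integrate (phi : test_function R d) : R :=
  complex.Re (torus_integral (fun x => F x * (phi x)%:C)).

Let integrateC phi : (integrate phi)%:C = torus_integral (fun x => F x * (phi x)%:C).
Proof.
rewrite /integrate; have := torus_integral_real (bFphi phi).
case: torus_integral => u v /= h; rewrite h// => x.
by rewrite ImM F_real/= mulr0 mul0r addr0.
Qed.

Let integrate_linear (t : R) (f g h : test_function R d) :
  (forall x, h x = t * f x + g x) -> integrate h = t * integrate f + integrate g.
Proof.
move=> hE.
suff : (integrate h)%:C = t%:C * (integrate f)%:C + (integrate g)%:C.
  by rewrite -rmorphM -rmorphD => /complexI.
rewrite !integrateC.
rewrite -torus_integralZ// -torus_integralD//; last first.
  exact: (bounded_measurableM (bounded_measurable_cst _ _)).
by congr torus_integral; apply/funext => x; rewrite hE rmorphD rmorphM/=; ring.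
Qed.

Let integrate_continuous : exists (C : R) (N : nat),
  forall (f : test_function R d) (M : R),
    (forall s x, (size s <= N)%N -> `|pderivs s f x| <= M) -> `|integrate f| <= C * M.
Proof.
have [_ _ [K FK]] := bF.
exists (2 * (2 * pi) ^+ d * K), 0%N => f M fM.
apply: le_trans (normr_Re_le _) _; rewrite -mulrA.
apply: cabs_torus_integral_le => // x; rewrite cabsM cabs_real.
by apply: ler_pM; rewrite ?cabs_ge0//; exact: (fM [::]).
Qed.

(** The functional is integration against F; it is real because F is, and it has
    order 0 because F is bounded. *)
Lemma regular_distribution :
  exists u : torus_distribution R d, forall k, dist_coef u k = fun_coef F k.
Proof.
exists (Distribution integrate_linear integrate_continuous) => k.
rewrite /dist_coef /=.
have -> : integrate (test_cos R k) -i* integrate (test_sin R k) =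
    (integrate (test_cos R k))%:C + - 'i%C * (integrate (test_sin R k))%:C.
  by apply/eqP; rewrite eq_complex/=; apply/andP; split; apply/eqP; ring.
rewrite !integrateC -torus_integralZ// -torus_integralD//; last first.
  exact: (bounded_measurableM (bounded_measurable_cst _ _)).
rewrite -torus_integralZ; last first.
  apply: bounded_measurableD => //.
  exact: (bounded_measurableM (bounded_measurable_cst _ _)).
congr torus_integral; apply/funext => x.
have -> : test_cos R k x = cos (phase k x) by rewrite /= /trig mul1r mul0r addr0.
have -> : test_sin R k x = sin (phase k x) by rewrite /= /trig mul1r mul0r add0r.
rewrite /fourier_basis [conjc _]conjcM conjc_real -[RHS]mulrA; congr (_ * _).
case: (F x) (F_real x) => a b /= ->.
by apply/eqP; rewrite eq_complex/=; apply/andP; split; apply/eqP; ring.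
Qed.

End RegularDistribution.

(** Each component is the distribution defined by the sum of its Fourier series,
    a bounded real function. *)
Lemma exists_vdistribution (R : realType) (d : nat) (U : 'rV[int]_d -> 'rV[R[i]]_d) :
  has_bounded_subsums (fun k => cnorm (U k)) ->
  (forall k, U (- k) = map_mx conjc (U k)) ->
  exists u : vdistribution R d, forall k, vcoef u k = U k.
Proof.
move=> bU UN; pose F s := fourier_series (fun k => U k 0 s).
have Ule s k : cabs (U k 0 s) <= cnorm (U k) by exact: cabs_le_cnorm.
have /boolp.choice[u uP] : forall s, exists u : torus_distribution R d,
    forall k, dist_coef u k = fun_coef (F s) k.
  move=> s; apply: regular_distribution.
    exact: bounded_measurable_series (Ule s) bU.
  apply: (fourier_series_real (Ule s) bU) => k.
  by rewrite UN mxE.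
exists u => k; apply/rowP => s; rewrite mxE uP.
exact: fun_coef_series (Ule s) bU.
Qed.

(** * The inequality and its sharp constant *)

Section NavierStokesEstimate.
Context (R : realType) (d : nat) (p n : R).
Hypotheses (d_gt0 : (0 < d)%N) (hn : d%:R / 2 < n) (hpn : n <= p).
Implicit Types (u v w : vdistribution R d).

Definition NS_majorant v w : R :=
  sobolev_norm p v * sobolev_norm (n + 1) w + sobolev_norm n v * sobolev_norm (p + 1) w.

Lemma NS_majorant_ge0 v w : 0 <= NS_majorant v w.
Proof. by rewrite addr_ge0// mulr_ge0 ?sobolev_norm_ge0. Qed.

Lemma Kplus_ge0 : 0 <= Kplus d p n.
Proof. by rewrite KplusE mulr_ge0 ?sqrtr_ge0// ltW// basis_norm_gt0. Qed.

(** As p > d/2, the l^2 bound on |k|^p |u_k| makes the coefficients absolutely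
    summable, so they are those of a distribution. *)
Lemma NS_bilinear_exists v w : sobolev p v -> sobolev (p + 1) w ->
  exists u, is_NS_bilinear v w u.
Proof.
move=> vS wS; apply: (@exists_vdistribution R d (NS_coef v w)).
- apply: (@weighted_l2_bounded_subsums R d p) => //.
  + exact: lt_le_trans hn hpn.
  + by move=> k; exact: cnorm_ge0.
  + by rewrite (NS_coef0 d_gt0 hn hpn vS wS) cnorm0.
  + by move=> A A0; exact: (NS_coef_subsum_le d_gt0 hn hpn vS wS A0).
- by move=> k; rewrite (NS_coefN d_gt0 hn hpn vS wS).
Qed.

Lemma NS_bilinear_bound v w u : sobolev p v -> sobolev (p + 1) w ->
  is_NS_bilinear v w u ->
  sobolev p u /\ sobolev_norm p u <= 2^-1 * Kplus d p n * NS_majorant v w.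
Proof.
move=> vS wS uE.
have {}uE k : vcoef u k = NS_coef v w k by exact: uE.
have B0 := bound_ge0 p n v w.
have sq : (sobolev_sqnorm p u <= ((2^-1 * Kplus d p n * NS_majorant v w) ^+ 2)%:E)%E.
  apply: esum_le_of_subsums => A A0; under eq_bigr do rewrite uE.
  by apply: (NS_coef_subsum_le d_gt0 hn hpn vS wS) => k /A0.
have uoo := le_lt_trans sq (ltry _).
split.
  split=> // [k|]; first by rewrite uE cdot_NS_coef.
  by rewrite uE (NS_coef0 d_gt0 hn hpn vS wS).
rewrite -ler_sqr ?nnegrE ?sobolev_norm_ge0// sobolev_norm_sqr -lee_fin fineK//.
by rewrite ge0_fin_numE ?sobolev_sqnorm_ge0.
Qed.

Lemma NS_constant_Kplus : NS_constant d p n (Kplus d p n).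
Proof.
split; first exact: Kplus_ge0.
by move=> v w vS wS u uE; case: (NS_bilinear_bound vS wS uE).
Qed.

(** Each admissibility condition is a non-strict inequality affine in the
    constant, so it passes to the infimum. *)
Lemma NS_constant_inf : NS_constant d p n (inf (NS_constant d p n)).
Proof.
have lb0 : lbound (NS_constant d p n) 0 by move=> K [].
split; first by apply: lb_le_inf; [exists (Kplus d p n); exact: NS_constant_Kplus|exact: lb0].
move=> v w vS wS u uE; rewrite -/(NS_majorant v w).
have [M0|M0] := eqVneq (NS_majorant v w) 0.
  by have := NS_constant_Kplus.2 v w vS wS u uE; rewrite -/(NS_majorant v w) M0 !mulr0.
have Mp : 0 < NS_majorant v w by rewrite lt_neqAle eq_sym M0 NS_majorant_ge0.
rewrite -ler_pdivrMr// -ler_pdivrMl ?invr_gt0// invrK.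
apply: lb_le_inf; first by exists (Kplus d p n); exact: NS_constant_Kplus.
move=> K [K0 /(_ v w vS wS u uE)]; rewrite -/(NS_majorant v w).
by rewrite -ler_pdivrMr// -ler_pdivrMl ?invr_gt0// invrK.
Qed.

End NavierStokesEstimate.

Unset Implicit Arguments.
Set Strict Implicit.

Theorem theorem3p3 (R : realType) (d : nat) (p n : R)
    (hd : (2 <= d)%N) (hn : d%:R / 2 < n) (hpn : n <= p) :
  (forall v w : vdistribution R d, sobolev p v -> sobolev (p + 1) w ->
     (exists u : vdistribution R d, is_NS_bilinear v w u) /\
     (forall u : vdistribution R d, is_NS_bilinear v w u ->
        sobolev p u /\
        sobolev_norm p u <= 2^-1 * Kplus d p n *
          (sobolev_norm p v * sobolev_norm (n + 1) w +
           sobolev_norm n v * sobolev_norm (p + 1) w))) /\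
  (exists Kpn : R,
     [/\ NS_constant d p n Kpn,
         (forall K : R, NS_constant d p n K -> Kpn <= K) &
         Kpn <= Kplus d p n]).
Proof.
have d_gt0 : (0 < d)%N by exact: ltnW.
split.
  move=> v w vS wS; split; first exact: (NS_bilinear_exists d_gt0 hn hpn vS wS).
  by move=> u uE; exact: (NS_bilinear_bound d_gt0 hn hpn vS wS uE).
have infP K : NS_constant d p n K -> inf (NS_constant d p n) <= K.
  by move=> hK; apply: ge_inf => //; exists 0 => ? [].
exists (inf (NS_constant d p n)); split => //.
- exact: NS_constant_inf d_gt0 hn hpn.
- by apply: infP; exact: NS_constant_Kplus d_gt0 hn hpn.
Qed.
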